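(* Let $j\ge1$ be an integer; for the A-type statements assume also $2j-1\not\equiv0\pmod{2n+1}$. (i) If $\gamma(\cdot,t)\in\mathcal{M}_{n+1,n}$ is a solution of the $(2j-1)$-th isotropic curve flow of B-type, $\gamma_t=gP_{2j-1,0}(u)e_1$ (respectively of A-type, $\gamma_t=gS_{2j-1,0}(u)e_1$), where $g(\cdot,t)$ and $u(\cdot,t)$ are the isotropic moving frame and isotropic curvature along $\gamma(\cdot,t)$, then $u$ is a solution of the $(2j-1)$-th $\hat B_n^{(1)}$-KdV flow $u_t=[\partial_x+b+u,P_{2j-1,0}(u)-\eta_j(u)]$ (respectively the $(2j-1)$-th $\hat A_{2n}^{(2)}$-KdV flow $u_t=[\partial_x+b+u,S_{2j-1,0}(u)-\tilde\eta_j(u)]$). (ii) Let $u:\mathbb{R}^2\to V_n$ be a solution of the $(2j-1)$-th $\hat B_n^{(1)}$-KdV flow (respectively $\hat A_{2n}^{(2)}$-KdV flow), let $c_0\in O(n+1,n)$ be a constant, and let $g:\mathbb{R}^2\to O(n+1,n)$ be the solution of $$g^{-1}g_x=b+u,\qquad g^{-1}g_t=P_{2j-1,0}(u)-\eta_j(u)\quad(\text{respectively } g^{-1}g_t=S_{2j-1,0}(u)-\tilde\eta_j(u))$$ with $g(0,0)=c_0$. Then $\gamma(x,t):=g(x,t)e_1$ is a solution of the $(2j-1)$-th isotropic curve flow of B-type (respectively A-type) with isotropic curvature $u(\cdot,t)$, and $g(\cdot,t)$ is the isotropic moving frame along $\gamma(\cdot,t)$.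
   Context: Let $n\ge 1$, let $e_{i,j}$ be the $(2n+1)\times(2n+1)$ elementary matrices, $C_n=\sum_{i=1}^{2n+1}(-1)^{n+i-1}e_{i,2n+2-i}$, $\mathbb{R}^{n+1,n}=\mathbb{R}^{2n+1}$ with $\langle X,Y\rangle=X^tC_nY$, $O(n+1,n)=\{A: A^tC_nA=C_n\}$ with Lie algebra $o(n+1,n)$, $\mathcal{N}_n^+$ the strictly upper triangular matrices in $o(n+1,n)$, and $e_1=(1,0,\dots,0)^t$. Put $b=\sum_{i=1}^{2n}e_{i+1,i}$, $\beta_i=e_{n+1-i,n+i}+e_{n+2-i,n+1+i}$, $V_n=\bigoplus_{i=1}^n\mathbb{R}\beta_i$. For matrix functions, $[\partial_x+A,B]=B_x+[A,B]$. Curves. A smooth $\gamma:\mathbb{R}\to\mathbb{R}^{n+1,n}$ is isotropic if $\gamma,\gamma_s,\dots,\gamma_s^{(2n)}$ are linearly independent and $\gamma,\dots,\gamma_s^{(n-1)}$ span a maximal isotropic subspace for every $s$. $\mathcal{M}_{n+1,n}$ is the set of isotropic curves with $\langle\gamma_x^{(n)},\gamma_x^{(n)}\rangle\equiv1$. The isotropic moving frame of $\gamma\in\mathcal{M}_{n+1,n}$ is the unique smooth $g:\mathbb{R}\to O(n+1,n)$ whose $i$-th column is $\gamma_x^{(i-1)}$ for $1\le i\le n+1$ and with $u=g^{-1}g_x-b\in C^\infty(\mathbb{R},V_n)$; $u$ is the isotropic curvature. B-type. $\hat B_n^{(1)}$ is the algebra of formal series $\sum_{i\le m_0}\xi_i\lambda^i$,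 $\xi_i\in o(n+1,n)$. Let $\beta=\frac12(e_{1,2n}+e_{2,2n+1})$, $J_B=b+\beta\lambda$; then $J_B^{2n+1}=\lambda J_B$. For $u\in C^\infty(\mathbb{R},V_n)$, $P(u,\lambda)$ is the unique $\hat B_n^{(1)}$-valued function of $x$ with $[\partial_x+J_B+u,P(u,\lambda)]=0$ that is conjugate to $J_B$ (in particular $P^{2n+1}=\lambda P$) and has leading term $J_B$, i.e. $P-J_B$ contains only terms of degree $\le0$ when $e_{i,j}\lambda^k$ has degree $i-j+2nk$. Write $P^{2j-1}(u,\lambda)=\sum_iP_{2j-1,i}(u)\lambda^i$. $\eta_j(u)\in C^\infty(\mathbb{R},\mathcal{N}_n^+)$ is the unique differential polynomial in $u$ with $[\partial_x+b+u,P_{2j-1,0}(u)-\eta_j(u)]\in C^\infty(\mathbb{R},V_n)$. A-type. $\hat A_{2n}^{(2)}$ is the algebra of formal series $\xi(\lambda)=\sum_{i\le m_0}\xi_i\lambda^i$, $\xi_i\in sl(2n+1,\mathbb{R})$, with $C_n\xi(-\lambda)^tC_n+\xi(\lambda)=0$. Let $J=b+e_{1,2n+1}\lambda$; then $J^{2n+1}=\lambda I$. $S(u,\lambda)$ is the unique $\hat A_{2n}^{(2)}$-valued function of $x$ with $[\partial_x+J+u,S(u,\lambda)]=0$ that is conjugate to $J$ (in particular $S^{2n+1}=\lambda I$) and has leading term $J$, i.e. $S-J$ contains only terms of degree $\le0$ when $e_{i,j}\lambda^k$ has degree $i-j+(2n+1)k$. Write $S^{2j-1}(u,\lambda)=\sum_iS_{2j-1,i}(u)\lambda^i$.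 $\tilde\eta_j(u)\in C^\infty(\mathbb{R},\mathcal{N}_n^+)$ is the unique differential polynomial in $u$ with $[\partial_x+b+u,S_{2j-1,0}(u)-\tilde\eta_j(u)]\in C^\infty(\mathbb{R},V_n)$. All $P_{2j-1,i}(u)$, $S_{2j-1,i}(u)$ are differential polynomials in $u$. *)

(* Defs.v *)
From mathcomp Require Import all_boot all_order all_algebra.
From mathcomp Require Import all_classical all_reals all_analysis.

Set Implicit Arguments.
Unset Strict Implicit.
Unset Printing Implicit Defensive.

Import Order.TTheory GRing.Theory Num.Theory.
Import numFieldNormedType.Exports.

Local Open Scope ring_scope.
Local Open Scope classical_set_scope.

(* C^oo: all iterated directional derivatives exist and are continuous.
   Used with V := R and V := R * R. *)
Definition smooth (R : realType) (V W : normedModType R) (f : V -> W) : Prop :=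
  forall s : seq V, let Df := foldr (fun v h => 'D_v h) f s in
    continuous Df /\ (forall a v, derivable Df a v).

Definition smooth2 (R : realType) (W : normedModType R) (f : R -> R -> W) :
    Prop :=
  smooth (fun z : R * R => f z.1 z.2).

Notation Mat R n := 'M[R]_((2 * n).+1).
Notation Vec R n := 'cV[R]_((2 * n).+1).

Section Matrices.
Variables (R : realType) (n : nat).

Local Notation mat := (Mat R n).
Local Notation vec := (Vec R n).

(* Elementary matrices with 1-based indices, 1 <= i, j <= 2n+1. *)
Definition e_ (i j : nat) : mat := delta_mx (inord i.-1) (inord j.-1).

Definition e1 : vec := delta_mx ord0 ord0.

Definition Cn : mat :=
  \sum_(1 <= i < 2 * n + 2) (-1) ^+ (n + i - 1) *: e_ i (2 * n + 2 - i).

Definition pairing (X Y : vec) : R := (X^T *m Cn *m Y) ord0 ord0.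

Definition inO (A : mat) : Prop := A^T *m Cn *m A = Cn.

Definition ino (A : mat) : Prop := A^T *m Cn + Cn *m A = 0.

Definition inNplus (A : mat) : Prop :=
  ino A /\ (forall i j : 'I_(2 * n).+1, (j <= i)%N -> A i j = 0).

Definition b_n : mat := \sum_(1 <= i < 2 * n + 1) e_ i.+1 i.

Definition beta_ (i : nat) : mat :=
  e_ (n + 1 - i) (n + i) + e_ (n + 2 - i) (n + 1 + i).

Definition inV (A : mat) : Prop :=
  exists c : nat -> R, A = \sum_(1 <= i < n + 1) c i *: beta_ i.

Definition CV (u : R -> mat) : Prop := smooth u /\ (forall x, inV (u x)).

(* [d/dx + A, B] = B_x + [A, B] *)
Definition comm_dx (A B : R -> mat) : R -> mat :=
  fun x => derive1 B x + (A x *m B x - B x *m A x).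

Definition isotropic (U : {vspace vec}) : Prop :=
  forall X Y, X \in U -> Y \in U -> pairing X Y = 0.

Definition maximal_isotropic (U : {vspace vec}) : Prop :=
  isotropic U /\
  (forall W : {vspace vec}, isotropic W -> (U <= W)%VS -> W = U).

Definition isotropic_curve (gamma : R -> vec) : Prop :=
  [/\ smooth gamma,
      forall x, free [seq derive1n k gamma x | k <- iota 0 (2 * n).+1] &
      forall x,
        maximal_isotropic <<[seq derive1n k gamma x | k <- iota 0 n]>>%VS].

Definition inM (gamma : R -> vec) : Prop :=
  isotropic_curve gamma /\
  (forall x, pairing (derive1n n gamma x) (derive1n n gamma x) = 1).

Definition curvature (g : R -> mat) : R -> mat :=
  fun x => invmx (g x) *m derive1 g x - b_n.

Definition moving_frame (gamma : R -> vec) (g : R -> mat) : Prop :=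
  [/\ smooth g,
      forall x, inO (g x),
      forall x i, (1 <= i <= n + 1)%N ->
        col (inord i.-1) (g x) = derive1n i.-1 gamma x &
      CV (curvature g)].

(* A formal series in lambda is given by its coefficients, indexed by int. *)
Definition loop_series := int -> mat.

Definition bounded_above (xi : loop_series) : Prop :=
  exists m0 : int, forall k, m0 < k -> xi k = 0.

Definition lconst (A : mat) : loop_series := fun k => if k == 0 then A else 0.

(* The sum is finite when both factors are bounded above. *)
Definition lmul (xi zeta : loop_series) : loop_series :=
  fun k => \sum_(i \in [set: int]) (xi i *m zeta (k - i)).

Definition lpow (xi : loop_series) (m : nat) : loop_series :=
  iter m (lmul xi) (lconst 1%:M).

Definition inB (xi : loop_series) : Prop :=
  bounded_above xi /\ (forall k, ino (xi k)).

(* The last condition is the coefficient of lambda^k in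
   Cn xi(-lambda)^t Cn + xi(lambda) = 0. *)
Definition inA (xi : loop_series) : Prop :=
  [/\ bounded_above xi,
      forall k, \tr (xi k) = 0 &
      forall k, (-1) ^ k *: (Cn *m (xi k)^T *m Cn) + xi k = 0].

Definition betaB : mat := 2^-1 *: (e_ 1 (2 * n) + e_ 2 (2 * n + 1)).

Definition JB : loop_series :=
  fun k => if k == 0 then b_n else if k == 1 then betaB else 0.

Definition JA : loop_series :=
  fun k => if k == 0 then b_n else if k == 1 then e_ 1 (2 * n + 1) else 0.

(* Conjugacy in the group of invertible matrices over R((1/lambda)). *)
Definition loop_conjugate (xi zeta : loop_series) : Prop :=
  exists T Tinv : loop_series,
    [/\ bounded_above T, bounded_above Tinv,
        lmul T Tinv = lconst 1%:M, lmul Tinv T = lconst 1%:M &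
        xi = lmul (lmul T zeta) Tinv].

(* Only terms of degree <= 0, where e_(i,j) lambda^k has degree i - j + d k. *)
Definition degree_le0 (d : nat) (xi : loop_series) : Prop :=
  forall (k : int) (i j : 'I_(2 * n).+1),
    xi k i j != 0 -> (i%:Z - j%:Z + d%:Z * k <= 0)%R.

(* The x-dependent series Q(u, lambda) attached to u by an algebra [alg], a
   leading term J and a grading in which lambda has degree d. *)
Definition dressing (alg : loop_series -> Prop) (J : loop_series) (d : nat)
    (u : R -> mat) (Q : R -> loop_series) : Prop :=
  [/\ forall k, smooth (fun x => Q x k),
      forall x, alg (Q x),
      forall x k,
        let L : loop_series := fun i => J i + lconst (u x) i in
        derive1 (fun y => Q y k) x + (lmul L (Q x) k - lmul (Q x) L k) = 0,
      forall x, loop_conjugate (Q x) J &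
      forall x, degree_le0 d (fun k => Q x k - J k)].

Definition is_P (P : (R -> mat) -> R -> loop_series) : Prop :=
  forall u, CV u -> dressing inB JB (2 * n) u (P u).

Definition is_S (S : (R -> mat) -> R -> loop_series) : Prop :=
  forall u, CV u -> dressing inA JA (2 * n + 1) u (S u).

(* Coefficient of lambda^0 in Q(u, lambda)^(2j-1). *)
Definition lambda0_coef (Q : (R -> mat) -> R -> loop_series) (j : nat) :
    (R -> mat) -> R -> mat :=
  fun u x => lpow (Q u x) (2 * j - 1) 0.

(* Scalar differential polynomials: polynomials in the x-derivatives of the
   entries of u. *)
Inductive diff_poly : ((R -> mat) -> R -> R) -> Prop :=
| diff_poly_cst c : diff_poly (fun _ _ => c)
| diff_poly_var m i j : diff_poly (fun u => derive1n m (fun y => u y i j))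
| diff_poly_add F G : diff_poly F -> diff_poly G ->
    diff_poly (fun u x => F u x + G u x)
| diff_poly_mul F G : diff_poly F -> diff_poly G ->
    diff_poly (fun u x => F u x * G u x).

Definition mx_diff_poly (F : (R -> mat) -> R -> mat) : Prop :=
  forall i j, exists2 f, diff_poly f &
    forall u, CV u -> forall x, F u x i j = f u x.

(* eta is the correction term attached to the operator Q0 = P_(2j-1,0),
   respectively S_(2j-1,0). *)
Definition is_eta (Q0 eta : (R -> mat) -> R -> mat) : Prop :=
  mx_diff_poly eta /\
  (forall u, CV u ->
    [/\ smooth (eta u),
        forall x, inNplus (eta u x) &
        CV (comm_dx (fun x => b_n + u x) (fun x => Q0 u x - eta u x))]).

(* gamma, g, u are functions of (x, t); [gamma^~ t] is gamma(., t). *)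
Definition curve_flow_solution (Q0 : (R -> mat) -> R -> mat)
    (gamma : R -> R -> vec) (g u : R -> R -> mat) : Prop :=
  [/\ smooth2 gamma,
      forall t, inM (gamma^~ t),
      forall t, moving_frame (gamma^~ t) (g^~ t),
      forall x t, u x t = curvature (g^~ t) x &
      forall x t, derive1 (gamma x) t = g x t *m Q0 (u^~ t) x *m e1].

Definition KdV_solution (Q0 eta : (R -> mat) -> R -> mat)
    (u : R -> R -> mat) : Prop :=
  [/\ smooth2 u,
      forall x t, inV (u x t) &
      forall x t, derive1 (u x) t =
        comm_dx (fun y => b_n + u y t)
                (fun y => Q0 (u^~ t) y - eta (u^~ t) y) x].

Definition frame_solution (Q0 eta : (R -> mat) -> R -> mat)
    (u : R -> R -> mat) (c0 : mat) (g : R -> R -> mat) : Prop :=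
  [/\ smooth2 g,
      forall x t, inO (g x t),
      forall x t, invmx (g x t) *m derive1 (g^~ t) x = b_n + u x t,
      forall x t, invmx (g x t) *m derive1 (g x) t =
        Q0 (u^~ t) x - eta (u^~ t) x &
      g 0 0 = c0].

End Matrices.

(* Main.v *)
Require Import Defs.
From mathcomp Require Import all_boot all_order all_algebra.
From mathcomp Require Import all_classical all_reals all_analysis.
From mathcomp Require Import ring zify.

Set Implicit Arguments.
Unset Strict Implicit.
Unset Printing Implicit Defensive.

Import Order.TTheory GRing.Theory Num.Theory.
Import numFieldNormedType.Exports.

Local Open Scope classical_set_scope.
Local Open Scope ring_scope.

(** Both flows are two descriptions of the time evolution of a moving frame g.
    Write Q0 for the lambda^0-coefficient of the odd power of P or S, and
    N = Q0 - eta. All that matters about Q0 is that it is smooth and takes values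
    in o(n+1,n) ([P_regular], [S_regular]): an odd power of an element of
    either loop algebra again satisfies its reality condition, and in the
    coefficient of lambda^0 the twist by lambda -> - lambda is invisible.

    From curves to KdV ([curve_to_KdV]): set M = g^-1 g_t. Equality of mixed
    derivatives gives u_t = [d/dx + b + u, M], which is V_n-valued; and
    [d/dx + b + u, N] is V_n-valued by the choice of eta. Moreover M and N agree
    on e1, because the curve is the first column of g and eta is strictly upper
    triangular. The heart of the proof is [rigidity]: an o(n+1,n)-valued D with
    D e1 = 0 and with [d/dx + b + u, D] in V_n is zero, which is seen column by
    column. Applied to D = M - N it gives M = N, that is the KdV equation. A
    point to be settled first is that g, which is a frame for each t separately,
    is smooth in (x, t); [frame_smooth2] recovers g and u from the derivatives of
    the curve by algebraic formulas.

    From KdV to curves ([KdV_to_curve]): as u is strictly upper triangular with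
    vanishing first n columns and b is the shift, the derivatives of g e1 are the
    columns of g up to order n, and unitriangular combinations of its columns
    beyond that order. So g e1 is isotropic with moving frame g, and its velocity is
    g N e1 = g Q0 e1. *)

(** * Smooth functions *)

Section SmoothCalculus.
Variable R : realType.
Implicit Types V W : normedModType R.

Lemma smooth_continuous V W (f : V -> W) : smooth f -> continuous f.
Proof. by move=> /(_ [::])[]. Qed.

Lemma smooth_derivable V W (f : V -> W) a v : smooth f -> derivable f a v.
Proof. by move=> /(_ [::])[_]; apply. Qed.

Lemma smooth_eq V W (f h : V -> W) :
  (forall x, f x = h x) -> smooth h -> smooth f.
Proof. by move=> /funext ->. Qed.

Lemma smooth_derive V W (f : V -> W) v : smooth f -> smooth ('D_v f).
Proof. by move=> sf s; have := sf (rcons s v); rewrite foldr_rcons. Qed.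

(** Smoothness is the largest class of C^1 functions stable under directional
    derivatives, so a function is smooth as soon as it belongs to some such
    class. *)
Lemma smooth_coind V W (Q : (V -> W) -> Prop) :
  (forall f, Q f -> continuous f /\ (forall a v, derivable f a v)) ->
  (forall f v, Q f -> Q ('D_v f)) ->
  forall f, Q f -> smooth f.
Proof.
move=> Q1 Q2 f Qf s; apply: Q1.
by elim: s => [//|v s IH] /=; apply: Q2.
Qed.

Lemma smooth_cst V W (c : W) : smooth (fun _ : V => c).
Proof.
apply: (smooth_coind (Q := fun f => exists c : W, f = fun=> c)).
- by move=> _ [d ->]; split => [x|a v]; [apply: cvg_cst|apply: derivable_cst].
- by move=> _ v [d ->]; exists 0; apply/funext => x; exact: derive_cst.
- by exists c.
Qed.

(** The algebra generated by the smooth functions: the Leibniz rule makes it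
    stable under derivatives, hence it contains only smooth functions. *)
Inductive smooth_alg V : (V -> R) -> Prop :=
| smooth_alg_gen f : smooth f -> smooth_alg f
| smooth_alg_add f g : smooth_alg f -> smooth_alg g -> smooth_alg (f + g)
| smooth_alg_mul f g : smooth_alg f -> smooth_alg g -> smooth_alg (f * g).

Lemma smooth_alg_C1 V (f : V -> R) : smooth_alg f ->
  continuous f /\ (forall a v, derivable f a v).
Proof.
elim=> {f} [f sf|f g _ [cf df] _ [cg dg]|f g _ [cf df] _ [cg dg]].
- by split => [|a v]; [exact: smooth_continuous|exact: smooth_derivable].
- by split => [x|a v]; [apply: cvgD; [exact: cf|exact: cg]|exact: derivableD].
- by split => [x|a v]; [apply: cvgM; [exact: cf|exact: cg]|exact: derivableM].
Qed.

Lemma smooth_alg_smooth V (f : V -> R) : smooth_alg f -> smooth f.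
Proof.
apply: smooth_coind => [|{}f v]; first exact: smooth_alg_C1.
elim=> {f} [f sf|f g Af A1 Ag A2|f g Af A1 Ag A2].
- exact/smooth_alg_gen/smooth_derive.
- have -> : 'D_v (f + g) = 'D_v f + 'D_v g; last exact: smooth_alg_add.
  apply/funext => x.
  by rewrite deriveD//; [exact: (smooth_alg_C1 Af).2|exact: (smooth_alg_C1 Ag).2].
- have -> : 'D_v (f * g) = f * 'D_v g + g * 'D_v f.
    apply/funext => x.
    by rewrite deriveM//; [exact: (smooth_alg_C1 Af).2|exact: (smooth_alg_C1 Ag).2].
  by apply: smooth_alg_add; apply: smooth_alg_mul.
Qed.

Lemma smoothD V (f g : V -> R) : smooth f -> smooth g -> smooth (fun x => f x + g x).
Proof.
move=> sf sg; change (smooth (f + g)).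
by apply/smooth_alg_smooth/smooth_alg_add; exact: smooth_alg_gen.
Qed.

Lemma smoothM V (f g : V -> R) : smooth f -> smooth g -> smooth (fun x => f x * g x).
Proof.
move=> sf sg; change (smooth (f * g)).
by apply/smooth_alg_smooth/smooth_alg_mul; exact: smooth_alg_gen.
Qed.

Lemma smooth_sum V I (r : seq I) (F : I -> V -> R) :
  (forall i, smooth (F i)) -> smooth (fun x => \sum_(i <- r) F i x).
Proof.
move=> sF; elim: r => [|i r IH].
  by eapply smooth_eq; [move=> x; rewrite big_nil; reflexivity|exact: smooth_cst].
by eapply smooth_eq; [move=> x; rewrite big_cons; reflexivity|exact: smoothD (sF i) IH].
Qed.

Lemma continuous_mx V p q (F : V -> 'M[R]_(p, q)) :
  (forall i j, continuous (fun x => F x i j)) -> continuous F.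
Proof.
move=> cF x A [P nP PA]; rewrite /fmap /=.
have : \forall y \near x, forall i j, P i j (F y i j).
  by apply: filter_forall => i; apply: filter_forall => j; exact: cF.
by apply: filterS => y; exact: PA.
Qed.

Lemma derive_mxE V p q (F : V -> 'M[R]_(p, q)) x v i j : derivable F x v ->
  'D_v F x i j = 'D_v (fun y => F y i j) x.
Proof. by move=> dF; rewrite derive_mx// mxE. Qed.

Lemma smooth_mxP V p q (F : V -> 'M[R]_(p, q)) :
  smooth F <-> (forall i j, smooth (fun x => F x i j)).
Proof.
split=> [sF i j|].
  pose Q (f : V -> R) := exists2 G : V -> 'M[R]_(p, q),
    smooth G & f = fun x => G x i j.
  apply: (@smooth_coind _ _ Q); last by exists F.
  - move=> _ [G sG ->]; split => [x|a v].
      apply: (@continuous_comp _ _ _ G (fun M : 'M[R]_(p, q) => M i j)).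
        exact: smooth_continuous.
      exact: coord_continuous.
    by apply: (derivable_mxP _ _ _).1; exact: smooth_derivable.
  - move=> _ v [G sG ->]; exists ('D_v G); first exact: smooth_derive.
    by apply/funext => x; rewrite derive_mxE//; exact: smooth_derivable.
apply: (@smooth_coind _ _ (fun G : V -> 'M[R]_(p, q) =>
  forall i j, smooth (fun x => G x i j))) => [{}F sF|{}F v sF i j].
  have dF a v : derivable F a v.
    by apply/derivable_mxP => i j; exact: smooth_derivable.
  by split => //; apply: continuous_mx => i j; exact: smooth_continuous.
have -> : (fun x => 'D_v F x i j) = 'D_v (fun x => F x i j).
  apply/funext => x; rewrite derive_mxE//.
  by apply/derivable_mxP => k l; exact: smooth_derivable.
exact: smooth_derive.
Qed.

Lemma smooth_mulmx V p q r (A : V -> 'M[R]_(p, q)) (B : V -> 'M[R]_(q, r)) :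
  smooth A -> smooth B -> smooth (fun x => A x *m B x).
Proof.
move=> /smooth_mxP sA /smooth_mxP sB; apply/smooth_mxP => i j.
eapply smooth_eq; [move=> x; rewrite mxE; reflexivity|apply: smooth_sum => k].
exact: (smoothM (sA i k) (sB k j)).
Qed.

Lemma smooth_addmx V p q (A B : V -> 'M[R]_(p, q)) :
  smooth A -> smooth B -> smooth (fun x => A x + B x).
Proof.
move=> /smooth_mxP sA /smooth_mxP sB; apply/smooth_mxP => i j.
by eapply smooth_eq;
  [move=> x; rewrite mxE; reflexivity|exact: (smoothD (sA i j) (sB i j))].
Qed.

Lemma smooth_scalemx V p q (c : V -> R) (A : V -> 'M[R]_(p, q)) :
  smooth c -> smooth A -> smooth (fun x => c x *: A x).
Proof.
move=> sc /smooth_mxP sA; apply/smooth_mxP => i j.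
by eapply smooth_eq; [move=> x; rewrite mxE; reflexivity|exact: (smoothM sc (sA i j))].
Qed.

Lemma smooth_submx V p q (A B : V -> 'M[R]_(p, q)) :
  smooth A -> smooth B -> smooth (fun x => A x - B x).
Proof.
move=> sA sB; refine (smooth_addmx sA _).
refine (@smooth_eq _ _ _ (fun x => (-1) *: B x) _ _) => [x|].
  by rewrite scaleN1r.
exact: smooth_scalemx (smooth_cst _) sB.
Qed.

Lemma smooth_trmx V p q (A : V -> 'M[R]_(p, q)) :
  smooth A -> smooth (fun x => (A x)^T).
Proof.
move=> /smooth_mxP sA; apply/smooth_mxP => i j.
by eapply smooth_eq; [move=> x; rewrite mxE; reflexivity|exact: sA].
Qed.

Lemma smooth_derive1 W (f : R -> W) : smooth f -> smooth (derive1 f).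
Proof.
move=> sf; rewrite (_ : derive1 f = 'D_1 f); first exact: smooth_derive.
by apply/funext => x; rewrite derive1E.
Qed.

Lemma derive1_mxE p q (F : R -> 'M[R]_(p, q)) x i j : derivable F x 1 ->
  derive1 F x i j = derive1 (fun y => F y i j) x.
Proof. by move=> dF; rewrite !derive1E derive_mxE. Qed.

Lemma derive1_sum I (r : seq I) (F : I -> R -> R) x :
  (forall i, derivable (F i) x 1) ->
  derivable (fun y => \sum_(i <- r) F i y) x 1 /\
  derive1 (fun y => \sum_(i <- r) F i y) x = \sum_(i <- r) derive1 (F i) x.
Proof.
move=> dF; elim: r => [|i r [dr IH]].
  under eq_fun do rewrite big_nil; rewrite big_nil.
  by split; [exact: derivable_cst|rewrite derive1_cst].
under eq_fun do rewrite big_cons.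
split; first exact: (derivableD (dF i) dr).
by rewrite big_cons -IH derive1E (deriveD (dF i) dr) !derive1E.
Qed.

Lemma derive1_mulmx p q r (A : R -> 'M[R]_(p, q)) (B : R -> 'M[R]_(q, r)) x :
  smooth A -> smooth B ->
  derive1 (fun y => A y *m B y) x = derive1 A x *m B x + A x *m derive1 B x.
Proof.
move=> sA sB; apply/matrixP => i j; rewrite derive1_mxE; last first.
  exact/smooth_derivable/smooth_mulmx.
under eq_fun do rewrite mxE.
have dA k : derivable (fun y => A y i k) x 1.
  by apply: (derivable_mxP _ _ _).1; exact: smooth_derivable.
have dB k : derivable (fun y => B y k j) x 1.
  by apply: (derivable_mxP _ _ _).1; exact: smooth_derivable.
rewrite (derive1_sum _ _).2; last by move=> k; exact: (derivableM (dA k) (dB k)).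
rewrite !mxE -big_split/=; apply: eq_bigr => k _.
rewrite !derive1_mxE; try exact: smooth_derivable.
rewrite !derive1E (deriveM (dA k) (dB k)) addrC.
by congr (_ + _); exact: mulrC.
Qed.

Lemma derive1_addmx p q (A B : R -> 'M[R]_(p, q)) x :
  smooth A -> smooth B ->
  derive1 (fun y => A y + B y) x = derive1 A x + derive1 B x.
Proof.
move=> sA sB; rewrite derive1E.
by rewrite (deriveD (smooth_derivable sA) (smooth_derivable sB)) !derive1E.
Qed.

Lemma derive1_submx p q (A B : R -> 'M[R]_(p, q)) x :
  smooth A -> smooth B ->
  derive1 (fun y => A y - B y) x = derive1 A x - derive1 B x.
Proof.
move=> sA sB; rewrite derive1E.
by rewrite (deriveB (smooth_derivable sA) (smooth_derivable sB)) !derive1E.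
Qed.

Lemma derive1_trmx p q (A : R -> 'M[R]_(p, q)) x :
  smooth A -> derive1 (fun y => (A y)^T) x = (derive1 A x)^T.
Proof.
move=> sA; apply/matrixP => i j; rewrite derive1_mxE; last first.
  exact/smooth_derivable/smooth_trmx.
rewrite mxE derive1_mxE; last exact: smooth_derivable.
by under eq_fun do rewrite mxE.
Qed.

End SmoothCalculus.

(** * Functions of two variables *)

Section TwoVariables.
Variable R : realType.

(** Along an affine map [phi] with linear part [dphi], the difference quotients
    of [f \o phi] are literally those of [f]. Slices of functions of two
    variables and the exchange of the variables are of this form. *)
Lemma growth_comp_affine (U V W : normedModType R) (phi dphi : U -> V)
    (f : V -> W) a w :
  (forall h : R, phi (h *: w + a) = h *: dphi w + phi a) ->
  (fun h : R => h^-1 *: ((f \o phi \o shift a) (h *: w) - (f \o phi) a))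
  = (fun h : R => h^-1 *: ((f \o shift (phi a)) (h *: dphi w) - f (phi a))).
Proof. by move=> phiE; apply/funext => h /=; rewrite phiE. Qed.

Lemma derivable_comp_affine (U V W : normedModType R) (phi dphi : U -> V)
    (f : V -> W) a w :
  (forall h : R, phi (h *: w + a) = h *: dphi w + phi a) ->
  derivable f (phi a) (dphi w) -> derivable (f \o phi) a w.
Proof. by move=> phiE; rewrite /derivable (growth_comp_affine _ phiE). Qed.

Lemma derive_comp_affine (U V W : normedModType R) (phi dphi : U -> V)
    (f : V -> W) a w :
  (forall h : R, phi (h *: w + a) = h *: dphi w + phi a) ->
  'D_w (f \o phi) a = 'D_(dphi w) f (phi a).
Proof. by move=> phiE; rewrite /derive (growth_comp_affine _ phiE). Qed.

Lemma smooth_comp_affine (U V W : normedModType R) (phi dphi : U -> V)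
    (f : V -> W) : continuous phi ->
  (forall (h : R) w a, phi (h *: w + a) = h *: dphi w + phi a) ->
  smooth f -> smooth (f \o phi).
Proof.
move=> cphi phiE sf.
pose Q (k : U -> W) := exists2 f : V -> W, smooth f & k = f \o phi.
apply: (@smooth_coind _ _ _ Q); last by exists f.
- move=> _ [k sk ->]; split => [x|a v].
    by apply: continuous_comp; [exact: cphi|exact: smooth_continuous].
  apply: (@derivable_comp_affine _ _ _ phi dphi k a v) => [h|]; first exact: phiE.
  exact: smooth_derivable.
- move=> _ v [k sk ->]; exists ('D_(dphi v) k); first exact: smooth_derive.
  by apply/funext => x; apply: derive_comp_affine => h; exact: phiE.
Qed.

Lemma smooth2_swap (W : normedModType R) (f : R -> R -> W) :
  smooth2 f -> smooth2 (fun t x => f x t).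
Proof.
move=> sf; pose sw (z : R * R) := (z.2, z.1).
apply: (@smooth_comp_affine _ _ _ sw sw _ _ _ sf) => // -[a b].
exact: (cvg_pair cvg_snd cvg_fst).
Qed.

Lemma smooth2_slicex (W : normedModType R) (f : R -> R -> W) t :
  smooth2 f -> smooth (f^~ t).
Proof.
move=> sf; apply: (@smooth_comp_affine _ _ _ (fun x => (x, t))
  (fun x => (x, 0)) _ _ _ sf) => [x|h w a].
  exact: (cvg_pair cvg_id (cvg_cst _)).
by congr pair; rewrite /= scaler0 add0r.
Qed.

Lemma smooth2_slicet (W : normedModType R) (f : R -> R -> W) x :
  smooth2 f -> smooth (f x).
Proof. by move=> /smooth2_swap/(smooth2_slicex x). Qed.

Lemma derive1_slicex (W : normedModType R) (f : R -> R -> W) x t :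
  derive1 (f^~ t) x = 'D_(1, 0) (fun z : R * R => f z.1 z.2) (x, t).
Proof.
rewrite derive1E; apply: (@derive_comp_affine _ _ _ (fun x => (x, t))
  (fun x => (x, 0)) (fun z : R * R => f z.1 z.2) x 1) => h.
by congr pair; rewrite /= scaler0 add0r.
Qed.

Lemma smooth2_derivex (W : normedModType R) (f : R -> R -> W) :
  smooth2 f -> smooth2 (fun x t => derive1 (f^~ t) x).
Proof.
move=> sf; refine (smooth_eq _ (@smooth_derive _ (R * R)%type W _ (1, 0) sf)).
by move=> [x t]; exact: derive1_slicex.
Qed.

Lemma smooth2_derivet (W : normedModType R) (f : R -> R -> W) :
  smooth2 f -> smooth2 (fun x t => derive1 (f x) t).
Proof. by move=> /smooth2_swap/smooth2_derivex/smooth2_swap. Qed.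

Lemma smooth_MVT (f : R -> R) (a b : R) : smooth f -> a < b ->
  exists2 c, a < c < b & f b - f a = derive1 f c * (b - a).
Proof.
move=> sf ab; have [||c] := @MVT R f (derive1 f) a b ab.
- by move=> x _; rewrite derive1E; apply/derivableP/smooth_derivable.
- exact/continuous_subspaceT/smooth_continuous.
by rewrite in_itv /= => cab E; exists c.
Qed.

(** The mean value theorem, once in each variable. *)
Lemma second_difference (f : R -> R -> R) (x t h : R) : smooth2 f -> 0 < h ->
  exists c d, [/\ x < c < x + h, t < d < t + h &
    f (x + h) (t + h) - f x (t + h) - (f (x + h) t - f x t) =
      derive1 (fun s => derive1 (f^~ s) c) d * h * h].
Proof.
move=> sf h0.
pose phi y := f y (t + h) - f y t.
have dphi y : derive1 phi y = derive1 (f^~ (t + h)) y - derive1 (f^~ t) y.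
  rewrite !derive1E [LHS]deriveB//; apply: smooth_derivable;
  exact: smooth2_slicex.
have sphi : smooth phi.
  apply: smoothD; first exact: smooth2_slicex.
  apply: (smooth_eq (h := (fun=> -1) * (f^~ t))) => [y|].
    by rewrite /GRing.mul /= mulN1r.
  by apply: smoothM; [exact: smooth_cst|exact: smooth2_slicex].
have xh : x < x + h by rewrite ltrDl.
have th : t < t + h by rewrite ltrDl.
have [c cx Ec] := smooth_MVT sphi xh.
have [d dt Ed] := smooth_MVT (smooth2_slicet c (smooth2_derivex sf)) th.
exists c, d; split => //.
have -> : f (x + h) (t + h) - f x (t + h) - (f (x + h) t - f x t) =
    phi (x + h) - phi x.
  by rewrite /phi; ring.
rewrite Ec dphi Ed.
by rewrite ![_ + h - _]addrAC !subrr !add0r.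
Qed.

Lemma continuous_box (h : R * R -> R) (x t e : R) : continuous h -> 0 < e ->
  exists2 r : R, 0 < r & forall c d, `|x - c| < r -> `|t - d| < r ->
    `|h (x, t) - h (c, d)| < e.
Proof.
move=> ch e0; have /cvgrPdist_lt/(_ _ e0) := ch (x, t).
move=> /nbhs_ballP[r /= r0 H]; exists r => // c d xc td.
by apply: (H (c, d)); split.
Qed.

(** Symmetry of second derivatives: the second difference over a small square
    is symmetric in the two variables, so each mixed derivative takes somewhere
    in the square the value that the other takes elsewhere in it; both are
    continuous. *)
Lemma derive1_comm_scalar (f : R -> R -> R) x t : smooth2 f ->
  derive1 (fun s => derive1 (f^~ s) x) t = derive1 (fun y => derive1 (f y) t) x.
Proof.
move=> sf.
pose F y s : R := derive1 (fun s => derive1 (f^~ s) y) s.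
pose G y s : R := derive1 (fun y => derive1 (f y) s) y.
have cF := smooth_continuous (smooth2_derivet (smooth2_derivex sf)).
have cG := smooth_continuous (smooth2_derivex (smooth2_derivet sf)).
rewrite -/(F x t) -/(G x t); apply/eqP; rewrite -subr_eq0 -normr_le0.
apply/ler_addgt0Pr => e e0; rewrite add0r.
have e20 : 0 < e / 2 by rewrite divr_gt0.
have [r1 r10 H1] := continuous_box x t cF e20.
have [r2 r20 H2] := continuous_box x t cG e20.
pose r := Num.min r1 r2; have r0 : 0 < r by rewrite lt_min r10.
have inb (y z : R) : y < z < y + r -> (`|y - z| < r1) /\ (`|y - z| < r2).
  move=> /andP[z1 z2]; have : `|y - z| < r.
    by rewrite distrC ger0_norm ?subr_ge0 ?ltW// ltrBlDl.
  by rewrite lt_min => /andP[].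
have [c [d [cx dt E1]]] := second_difference x t sf r0.
have [d' [c' [dt' cx' E2]]] := second_difference t x (smooth2_swap sf) r0.
have E : F c d = G c' d'.
  apply: (mulIf (lt0r_neq0 r0)); apply: (mulIf (lt0r_neq0 r0)).
  by rewrite -[LHS]E1 -[RHS]E2; ring.
have [xc _] := inb _ _ cx; have [td _] := inb _ _ dt.
have [_ xc'] := inb _ _ cx'; have [_ td'] := inb _ _ dt'.
have K1 : `|F x t - F c d| < e / 2 := H1 _ _ xc td.
have K2 : `|G x t - G c' d'| < e / 2 := H2 _ _ xc' td'.
move: (F x t) (G x t) (F c d) (G c' d') E K1 K2 => y z w _ <- yw zw.
apply: ltW; rewrite (splitr e); apply: le_lt_trans (ler_distD w y z) _.
by apply: ltrD => //; rewrite distrC.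
Qed.

Lemma smooth2_mxP p q (F : R -> R -> 'M[R]_(p, q)) :
  smooth2 F <-> (forall i j, smooth2 (fun x t => F x t i j)).
Proof. exact: smooth_mxP. Qed.

Lemma derive1_comm p q (f : R -> R -> 'M[R]_(p, q)) x t : smooth2 f ->
  derive1 (fun s => derive1 (f^~ s) x) t = derive1 (fun y => derive1 (f y) t) x.
Proof.
move=> sf; apply/matrixP => i j.
have Dx : derivable (fun s => derive1 (f^~ s) x) t 1.
  exact: smooth_derivable (smooth2_slicet x (smooth2_derivex sf)).
have Dt : derivable (fun y => derive1 (f y) t) x 1.
  exact: smooth_derivable (smooth2_slicex t (smooth2_derivet sf)).
have Ex s : derive1 (f^~ s) x i j = derive1 (fun y => f y s i j) x.
  exact: derive1_mxE i j (smooth_derivable (smooth2_slicex s sf)).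
have Et y : derive1 (f y) t i j = derive1 (fun s => f y s i j) t.
  exact: derive1_mxE i j (smooth_derivable (smooth2_slicet y sf)).
have Fx : derive1 (fun s => derive1 (f^~ s) x i j) t
    = derive1 (fun s => derive1 (fun y => f y s i j) x) t.
  by congr (derive1 _ t); apply/funext.
have Ft : derive1 (fun y => derive1 (f y) t i j) x
    = derive1 (fun y => derive1 (fun s => f y s i j) t) x.
  by congr (derive1 _ x); apply/funext.
have /smooth2_mxP sij := sf.
apply: etrans (derive1_mxE i j Dx) (etrans Fx _).
apply: etrans _ (etrans (esym Ft) (esym (derive1_mxE i j Dt))).
exact: (derive1_comm_scalar x t (sij i j)).
Qed.

End TwoVariables.

(** * The form, the shift and the space V_n *)

Section Algebra.
Variables (R : realType) (n : nat).
Local Notation mat := (Mat R n).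
Local Notation vec := (Vec R n).
Local Notation Cn := (Cn R n).
Local Notation b_n := (b_n R n).
Local Notation N := (2 * n).+1.

Lemma elem_mxE (i j : nat) (p q : 'I_N) : (0 < i <= N)%N -> (0 < j <= N)%N ->
  e_ R n i j p q = ((p.+1 == i) && (q.+1 == j))%:R.
Proof.
move=> /andP[i0 iN] /andP[j0 jN]; rewrite mxE -!val_eqE /= !inordK; try lia.
by congr ((_ && _)%:R); lia.
Qed.

Lemma CnE (p q : 'I_N) : Cn p q = if (p + q == 2 * n)%N then (-1) ^+ (n + p) else 0.
Proof.
rewrite summxE (eq_big_nat _ _ (F2 := fun i => if (i == p.+1)%N then
  (if (p + q == 2 * n)%N then (-1) ^+ (n + p) else 0) else 0)); last first.
  move=> i /andP[i0 iN]; rewrite mxE elem_mxE; try lia.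
  case: (eqVneq i p.+1) => [->|ip]; last first.
    by rewrite /= mulr0.
  rewrite /= (_ : (q.+1 == _)%N = (p + q == 2 * n)%N); last first.
    by have := ltn_ord q; have := ltn_ord p; lia.
  by case: ifP => _; rewrite ?mulr0 // mulr1; congr (_ ^+ _); lia.
rewrite -big_mkcond big_nat1_eq ifT //; have := ltn_ord p; lia.
Qed.

Lemma b_nE (p q : 'I_N) : b_n p q = (p == q.+1 :> nat)%:R.
Proof.
rewrite summxE (eq_big_nat _ _ (F2 := fun i => if (i == q.+1)%N then
  (p == q.+1 :> nat)%:R else 0)); last first.
  move=> i /andP[i0 iN]; rewrite elem_mxE; try lia.
  case: (eqVneq i q.+1) => [->|ip]; last first.
    by rewrite andbF.
  by rewrite andbT; congr ((_)%:R); lia.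
rewrite -big_mkcond big_nat1_eq; case: ifP => // H.
case: eqVneq => // E; have := ltn_ord p; have := ltn_ord q; lia.
Qed.

(** For [A] in V_n this is the coefficient of beta_(n-p): each beta_i has one
    entry with row and column indices (counted from 0) summing to 2n-1 and lying
    above the diagonal, namely in row n-i. *)
Definition Vcoord (A : mat) (p : nat) : R := A (inord p) (inord (2 * n - 1 - p)).

Lemma sum_betaE (c : nat -> R) (p q : 'I_N) :
  (\sum_(1 <= i < n + 1) c i *: beta_ R n i) p q =
  (if (p + q == 2 * n - 1)%N && (p < n)%N then c (n - p)%N else 0) +
  (if (p + q == 2 * n + 1)%N && (0 < p <= n)%N then c (n + 1 - p)%N else 0).
Proof.
rewrite summxE (eq_big_nat _ _ (F2 := fun i =>
  (if (i == n - p)%N then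
    (if (p + q == 2 * n - 1)%N && (p < n)%N then c (n - p)%N else 0) else 0) +
  (if (i == n + 1 - p)%N then
    (if (p + q == 2 * n + 1)%N && (0 < p <= n)%N then c (n + 1 - p)%N else 0)
    else 0))); last first.
  move=> i /andP[i0 iN]; rewrite mxE mxE !elem_mxE; try lia.
  rewrite mulrDr; congr (_ + _).
    case: (eqVneq i (n - p)%N) => [Ei|Ei].
      rewrite Ei (_ : _ && _ = (p + q == 2 * n - 1)%N && (p < n)%N); last by lia.
      by case: ifP; rewrite ?mulr0 ?mulr1.
    by rewrite (_ : _ && _ = false) ?mulr0 //; lia.
  case: (eqVneq i (n + 1 - p)%N) => [Ei|Ei].
    rewrite Ei (_ : _ && _ = (p + q == 2 * n + 1)%N && (0 < p <= n)%N);
      last by lia.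
    by case: ifP; rewrite ?mulr0 ?mulr1.
  by rewrite (_ : _ && _ = false) ?mulr0 //; lia.
rewrite big_split -!big_mkcond !big_nat1_eq /=.
congr (_ + _); case: ifP => // H; case: ifP => // K; lia.
Qed.

Lemma Vcoord_sum (c : nat -> R) (p : nat) : (p < n)%N ->
  Vcoord (\sum_(1 <= i < n + 1) c i *: beta_ R n i) p = c (n - p)%N.
Proof.
move=> pn; have pN : (p < N)%N by lia.
have qN : (2 * n - 1 - p < N)%N by lia.
rewrite /Vcoord sum_betaE (inordK pN) (inordK qN).
have -> : (p + (2 * n - 1 - p) == 2 * n - 1)%N by lia.
have -> : (p + (2 * n - 1 - p) == 2 * n + 1)%N = false by lia.
by rewrite pn addr0.
Qed.

Lemma inV_entry (A : mat) (p q : 'I_N) : inV A -> A p q =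
  (if (p + q == 2 * n - 1)%N && (p < n)%N then Vcoord A p else 0) +
  (if (p + q == 2 * n + 1)%N && (0 < p <= n)%N then Vcoord A p.-1 else 0).
Proof.
move=> [c ->]; rewrite sum_betaE; congr (_ + _); case: ifP => // /andP[_ pn].
  by rewrite Vcoord_sum.
have p1 : (p.-1 < n)%N by lia.
by rewrite (Vcoord_sum c p1); congr c; lia.
Qed.

(** The coefficients of an element of V_n are entries of it, hence depend on it
    linearly and smoothly. *)
Lemma inV_decomp (A : mat) : inV A ->
  A = \sum_(1 <= i < n + 1) Vcoord A (n - i) *: beta_ R n i.
Proof.
move=> AV; apply/matrixP => p q; rewrite inV_entry // sum_betaE; congr (_ + _).
  by case: ifP => // /andP[/eqP pq pn]; congr Vcoord; lia.
by case: ifP => // /andP[/eqP pq pn]; congr Vcoord; lia.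
Qed.

Lemma inV_sub (A B : mat) : inV A -> inV B -> inV (A - B).
Proof.
move=> [c ->] [d ->]; exists (fun i => c i - d i); rewrite -sumrB.
by apply: eq_bigr => i _; rewrite scalerBl.
Qed.

(** Columns are counted from 0, so [e1] is [stdcol 0] and the middle column has
    index n. *)
Definition stdcol (k : nat) : vec := delta_mx (inord k) 0.
Local Notation E := stdcol.

Lemma mulmx_stdcol (A : mat) k (p : 'I_N) : (A *m E k) p 0 = A p (inord k).
Proof. by rewrite -colE mxE. Qed.

Lemma bn_stdcol k : (k < 2 * n)%N -> b_n *m E k = E k.+1.
Proof.
move=> kn; apply/matrixP => p z.
rewrite ord1 mulmx_stdcol b_nE mxE eqxx andbT -val_eqE /=.
by rewrite !inordK //; lia.
Qed.

(** Each column of an element of V_n has at most two nonzero entries: one new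
    coefficient, and the one that already occurred in the column before. *)
Lemma inV_stdcol (A : mat) k : inV A -> (k <= 2 * n)%N -> A *m E k =
  (if (n <= k < 2 * n)%N then Vcoord A (2 * n - 1 - k) else 0) *: E (2 * n - 1 - k)
  + (if (n < k)%N then Vcoord A (2 * n - k) else 0) *: E (2 * n + 1 - k).
Proof.
move=> AV kn; apply/matrixP => p z; rewrite ord1 mulmx_stdcol inV_entry //.
rewrite inordK; last by lia.
rewrite !mxE eqxx !andbT -!val_eqE /=; have := ltn_ord p => pN.
congr (_ + _).
  rewrite inordK; last by lia.
  case: (eqVneq (nat_of_ord p) (2 * n - 1 - k)%N) => [->|pk].
    rewrite mulr1; case: ifP => H; case: ifP => H' //; lia.
  by rewrite mulr0 ifF //; lia.
case: (ltnP n k) => nk; last by rewrite mul0r ifF //; lia.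
rewrite inordK; last by lia.
case: (eqVneq (nat_of_ord p) (2 * n + 1 - k)%N) => [->|pk].
  rewrite mulr1 ifT; last by lia.
  by congr Vcoord; lia.
by rewrite mulr0 ifF //; lia.
Qed.

Lemma e1_stdcol : e1 R n = E 0.
Proof. by rewrite /e1 /E; congr delta_mx; apply: val_inj; rewrite /= inordK. Qed.

Lemma mx_stdcol_inj (A B : mat) :
  (forall k, (k <= 2 * n)%N -> A *m E k = B *m E k) -> A = B.
Proof.
move=> H; apply/matrixP => p q.
have /matrixP/(_ p 0) := H q (leq_ord q).
by rewrite !mulmx_stdcol inord_val.
Qed.

Lemma Cn_mulE r (A : 'M[R]_(N, r)) (p : 'I_N) q :
  (Cn *m A) p q = (-1) ^+ (n + p) * A (rev_ord p) q.
Proof.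
rewrite mxE (bigD1 (rev_ord p)) //= big1 => [|k kp].
  rewrite CnE addr0 ifT //=; have := ltn_ord p; lia.
rewrite CnE ifF ?mul0r //; apply: contraNF kp => /eqP pk.
by apply/eqP/val_inj => /=; lia.
Qed.

Lemma Cn_sq : Cn *m Cn = 1%:M.
Proof.
apply/matrixP => p q; rewrite Cn_mulE CnE mxE -val_eqE /=.
have := ltn_ord p; have := ltn_ord q => qn pn.
case: (eqVneq (nat_of_ord p) q) => [pq|pq].
  rewrite ifT; last by lia.
  rewrite -exprD (_ : (_ + _)%N = (2 * (2 * n))%N) ?exprM ?sqrrN ?expr1n //.
  by lia.
by rewrite ifF ?mulr0 //; lia.
Qed.

Lemma trmx_Cn : Cn^T = Cn.
Proof.
apply/matrixP => p q; rewrite mxE !CnE addnC; case: ifP => // /eqP pq.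
by rewrite -signr_odd -[RHS]signr_odd; congr (_ ^+ _); lia.
Qed.

Lemma ino_skew (A : mat) : ino A -> (Cn *m A)^T = - (Cn *m A).
Proof. by move=> /addr0_eq; rewrite trmx_mul trmx_Cn => <-; rewrite opprK. Qed.

(** [Cn *m A] is skew, so its diagonal, which is the antidiagonal of [A] up to
    signs, vanishes. *)
Lemma ino_antidiag (A : mat) (p q : 'I_N) : ino A -> (p + q = 2 * n)%N -> A p q = 0.
Proof.
move=> /ino_skew/matrixP/(_ q q); rewrite [LHS]mxE [RHS]mxE Cn_mulE => /eqP.
rewrite -addr_eq0 -mulr2n mulrn_eq0 /= mulf_eq0 signr_eq0 /= => /eqP + pq.
by congr (_ = 0); congr (A _ _); apply: val_inj => /=; lia.
Qed.

Lemma ino_sub (A B : mat) : ino A -> ino B -> ino (A - B).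
Proof.
rewrite /ino => HA HB; rewrite linearB /= mulmxBl mulmxBr.
by rewrite addrACA HA -opprD HB subr0.
Qed.

Lemma inO_invmx (A : mat) : inO A ->
  [/\ invmx A = Cn *m A^T *m Cn, invmx A *m A = 1%:M & A *m invmx A = 1%:M].
Proof.
move=> AO; have H : (Cn *m A^T *m Cn) *m A = 1%:M.
  by rewrite -!mulmxA (mulmxA A^T) AO Cn_sq.
have [_ uA] := mulmx1_unit H.
split; [|exact: mulVmx|exact: mulmxV].
by rewrite -[RHS](mulmxK uA) H mul1mx.
Qed.

Lemma inO_form (A : mat) (X Y : vec) : inO A ->
  pairing (A *m X) (A *m Y) = pairing X Y.
Proof.
move=> AO; rewrite /pairing trmx_mul -!mulmxA.
by rewrite (mulmxA Cn) (mulmxA A^T) (mulmxA A^T) AO.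
Qed.

Lemma pairing_stdcol k l : (k <= 2 * n)%N -> (l <= 2 * n)%N ->
  pairing (E k) (E l) = if (k + l == 2 * n)%N then (-1) ^+ (n + k) else 0.
Proof.
move=> kn ln; rewrite /pairing /E trmx_delta -rowE -colE !mxE CnE !inordK //; lia.
Qed.

End Algebra.

(** * Odd powers of loop-algebra elements *)

Section LoopPowers.
Variables (R : realType) (n : nat).
Local Notation mat := (Mat R n).
Local Notation Cn := (Cn R n).
Local Notation N := (2 * n).+1.
Implicit Types (xi zeta : loop_series R n).

(** A product of series bounded above by [a] and [b] is a Cauchy product when
    the coefficients are counted downwards from the top. *)
Lemma lmul_coef xi zeta (a b : int) (l : nat) :
  (forall k, a < k -> xi k = 0) -> (forall k, b < k -> zeta k = 0) ->
  lmul xi zeta (a + b - l%:Z) =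
    \sum_(i < l.+1) xi (a - i%:Z) *m zeta (b - (l - i)%:Z).
Proof.
move=> xa zb; rewrite /lmul.
rewrite (fsbigE [seq a - i%:Z | i <- iota 0 l.+1]); last first.
- move=> k _; apply: contraNeq => H; apply/mapP; exists `|a - k|%N; last first.
    case: (lerP k a) => ka; first by lia.
    by rewrite xa ?mul0mx ?eqxx in H.
  rewrite mem_iota; case: (lerP k a) => ka; last by rewrite xa ?mul0mx ?eqxx in H.
  case: (lerP (a - l%:Z) k) => kl; first by lia.
  rewrite zb ?mulmx0 ?eqxx // in H; lia.
- by [].
- by rewrite map_inj_uniq ?iota_uniq // => i1 i2; lia.
rewrite big_map big_mkcond
  (eq_bigr (fun i : nat => xi (a - i%:Z) *m zeta (b - (l%:Z - i%:Z)))).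
  rewrite -[iota _ _]/(index_iota 0 l.+1) big_mkord.
  by apply: eq_bigr => i _; congr (_ *m zeta _); have := ltn_ord i; lia.
move=> i _; rewrite mem_set //; congr (_ *m zeta _); lia.
Qed.

Lemma lmul_bound xi zeta (a b : int) k :
  (forall k, a < k -> xi k = 0) -> (forall k, b < k -> zeta k = 0) ->
  a + b < k -> lmul xi zeta k = 0.
Proof.
move=> xa zb abk; rewrite /lmul fsbig1 // => i _.
case: (ltrP a i) => ai; first by rewrite xa ?mul0mx.
by rewrite zb ?mulmx0 //; lia.
Qed.

Lemma lpow_bound xi m k : (forall k, 1 < k -> xi k = 0) -> m%:Z < k -> lpow xi m k = 0.
Proof.
move=> x1; elim: m k => [|m IH] k mk.
  by rewrite /lpow /= /lconst ifF //; apply/negbTE; lia.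
by apply: (lmul_bound x1 IH); lia.
Qed.

(** The top [K.+1] coefficients of a series in lambda without terms above
    lambda^1, as a polynomial in lambda^-1. It turns powers of formal series into
    powers in an associative ring, where both [exprS] and [exprSr] hold. *)
Definition trunc (K : nat) xi : {poly mat} := \poly_(l < K.+1) xi (1 - l%:Z).

Lemma lpow_coef xi m K l : (forall k, 1 < k -> xi k = 0) -> (l <= K)%N ->
  lpow xi m (m%:Z - l%:Z) = (trunc K xi ^+ m)`_l.
Proof.
move=> x1; elim: m l => [|m IH] l lK.
  rewrite expr0 coef1 /lpow /= /lconst sub0r oppr_eq0.
  by rewrite (_ : (l%:Z == 0) = (l == 0%N)) //; case: ifP.
rewrite exprS coefM (_ : m.+1%:Z - l%:Z = 1 + m%:Z - l%:Z); last by lia.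
rewrite [LHS](lmul_coef l x1 (fun k => lpow_bound (m := m) x1)).
apply: eq_bigr => i _; rewrite coef_poly ifT; last by have := ltn_ord i; lia.
by rewrite -IH //; have := ltn_ord i; lia.
Qed.

Lemma smooth_summx (V : normedModType R) p q m (F : 'I_m -> V -> 'M[R]_(p, q)) :
  (forall i, smooth (F i)) -> smooth (fun x => \sum_(i < m) F i x).
Proof.
move=> sF; apply/smooth_mxP => i j.
refine (smooth_eq _ (smooth_sum (index_enum _)
  (fun k => (smooth_mxP (F k)).1 (sF k) i j))).
by move=> x; rewrite summxE.
Qed.

Lemma smooth_trunc_pow (Q : R -> loop_series R n) K m l :
  (forall k, smooth (fun x => Q x k)) ->
  smooth (fun x => (trunc K (Q x) ^+ m)`_l : mat).
Proof.
move=> sQ; elim: m l => [|m IH] l.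
  refine (smooth_eq _ (smooth_cst ((1 : {poly mat})`_l : mat))) => x.
  by rewrite expr0.
refine (smooth_eq _ (smooth_summx (F := fun (i : 'I_l.+1) x =>
  (trunc K (Q x))`_i *m (trunc K (Q x) ^+ m)`_(l - i)) _)).
  by move=> x; rewrite exprS coefM.
move=> i; refine (smooth_mulmx _ (IH _)).
case: (ltnP i K.+1) => iK.
  refine (smooth_eq _ (sQ (1 - i%:Z))) => x.
  by rewrite coef_poly iK.
refine (smooth_eq _ (smooth_cst (0 : mat))) => x.
by rewrite coef_poly ltnNge iK.
Qed.

(** The adjoint for the form defined by [Cn]. *)
Definition cadj (A : mat) : mat := Cn *m A^T *m Cn.

Lemma cadj_mul (A B : mat) : cadj (A *m B) = cadj B *m cadj A.
Proof.
rewrite /cadj trmx_mul -!mulmxA; do 2 congr (_ *m _).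
by rewrite !mulmxA Cn_sq mul1mx.
Qed.

Lemma cadj0 : cadj 0 = 0. Proof. by rewrite /cadj trmx0 mulmx0 mul0mx. Qed.

Lemma cadj_sum m (F : 'I_m -> mat) : cadj (\sum_i F i) = \sum_i cadj (F i).
Proof. apply: (big_morph cadj _ cadj0) => A B.
by rewrite /cadj [(A + B)^T]raddfD /= mulmxDr mulmxDl.
Qed.

Lemma inoP (A : mat) : ino A <-> cadj A = - A.
Proof.
split=> [/addr0_eq H|H].
  by rewrite /cadj -mulmxA -[A^T *m Cn]opprK H mulmxN mulmxA Cn_sq mul1mx.
rewrite /ino -[A^T](mul1mx) -Cn_sq -!mulmxA (mulmxA Cn A^T).
by rewrite -/(cadj A) H mulmxN addNr.
Qed.

(** With [s = 1] the hypothesis says that a series in lambda^-1 has values in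
    o(n+1,n), with [s = -1] that it satisfies the twisted reality condition of
    the A-type algebra; the shift [l.+1] accounts for the leading term being
    lambda^1. The adjoint is an anti-automorphism, so it maps the coefficients of
    p * p^m to those of p^m * p, up to sign. *)
Lemma cadj_pow (p : {poly mat}) (s : R) m l :
  (forall l, cadj p`_l = - (s ^+ l.+1 *: p`_l)) ->
  cadj (p ^+ m)`_l = ((-1) ^+ m * s ^+ (m + l)) *: (p ^+ m)`_l.
Proof.
move=> Hp; elim: m l => [|m IH] l.
  rewrite expr0 coef1; case: l => [|l] /=; last by rewrite cadj0 scaler0.
  by rewrite mul1r expr0 scale1r /cadj trmx1 mulmx1 Cn_sq.
rewrite [p ^+ _ in LHS]exprS [p ^+ _ in RHS]exprSr [in RHS]coefMr [in LHS]coefM.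
rewrite cadj_sum scaler_sumr.
apply: eq_bigr => i _; rewrite [LHS]cadj_mul IH Hp.
rewrite mulmxN -scalemxAl -scalemxAr scalerA -scaleNr; congr (_ *: _).
rewrite [(-1) ^+ m.+1]exprS mulN1r mulNr; congr (- _).
rewrite -mulrA -exprD; congr (_ * s ^+ _).
by have := ltn_ord i; lia.
Qed.

(** In an odd power the coefficient of lambda^0 is untwisted: there the sign is
    (-1)^m s^(2m) = -1 in both types. *)
Lemma lpow_ino xi (s : R) j : (1 <= j)%N ->
  (s ^+ 2 = 1) -> (forall k, 1 < k -> xi k = 0) ->
  (forall l : nat, cadj (xi (1 - l%:Z)) = - (s ^+ l.+1 *: xi (1 - l%:Z))) ->
  ino (lpow xi (2 * j - 1) 0).
Proof.
move=> j1 s2 x1 Hx; set m := (2 * j - 1)%N; apply/inoP.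
have := lpow_coef m x1 (leqnn m); rewrite subrr => ->.
rewrite (@cadj_pow _ s) => [|l]; last first.
  by rewrite coef_poly; case: ifP => _; rewrite ?cadj0 ?scaler0 ?oppr0.
rewrite addnn -mul2n exprM s2 expr1n mulr1 -signr_odd.
by rewrite (_ : odd m) ?expr1 ?scaleN1r // /m; lia.
Qed.

(** The degree condition bounds the powers of lambda uniformly in x, because row
    and column indices differ by at most 2n. *)
Lemma dressing_bound alg J d u Q : (2 * n <= d)%N -> (0 < n)%N ->
  (forall k, 1 < k -> J k = 0) -> @dressing R n alg J d u Q ->
  forall x k, 1 < k -> Q x k = 0.
Proof.
move=> nd n0 J1 [_ _ _ _ dg] x k k1; apply/matrixP => p q; rewrite [RHS]mxE.
apply/eqP; have := dg x k p q; rewrite J1 // subr0 => H.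
apply: contraT => /H; have := ltn_ord p; have := ltn_ord q; nia.
Qed.

Lemma JB_bound k : 1 < k -> JB R n k = 0.
Proof. by move=> k1; rewrite /JB !ifF //; apply/negbTE; lia. Qed.

Lemma JA_bound k : 1 < k -> JA R n k = 0.
Proof. by move=> k1; rewrite /JA !ifF //; apply/negbTE; lia. Qed.

Lemma lambda0_smooth alg J d u (Q : (R -> mat) -> R -> loop_series R n) j :
  (2 * n <= d)%N -> (0 < n)%N -> (forall k, 1 < k -> J k = 0) ->
  dressing alg J d u (Q u) -> smooth (lambda0_coef Q j u).
Proof.
move=> nd n0 J1 dQ; have Q1 := dressing_bound nd n0 J1 dQ.
have [sQ _ _ _ _] := dQ; set m := (2 * j - 1)%N.
refine (smooth_eq _ (smooth_trunc_pow m m m sQ)) => x.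
by have := lpow_coef m (Q1 x) (leqnn m); rewrite subrr.
Qed.

Lemma P_regular P j u : (1 <= n)%N -> (1 <= j)%N -> @is_P R n P -> CV u ->
  smooth (lambda0_coef P j u) /\ forall x, ino (lambda0_coef P j u x).
Proof.
move=> n0 j0 PP uV; have dP := PP u uV; split.
  exact: lambda0_smooth (leqnn _) n0 JB_bound dP.
move=> x; apply: (@lpow_ino _ 1) => //; rewrite ?expr1n //.
  exact: dressing_bound (leqnn _) n0 JB_bound dP x.
move=> l; rewrite expr1n scale1r; have [_ /(_ x)[_ H] _ _ _] := dP.
exact/inoP.
Qed.

Lemma S_regular S j u : (1 <= n)%N -> (1 <= j)%N -> @is_S R n S -> CV u ->
  smooth (lambda0_coef S j u) /\ forall x, ino (lambda0_coef S j u x).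
Proof.
move=> n0 j0 SS uV; have dS := SS u uV.
have nd : (2 * n <= 2 * n + 1)%N by lia.
split; first exact: lambda0_smooth nd n0 JA_bound dS.
move=> x; apply: (@lpow_ino _ (-1)) => //; rewrite ?sqrrN ?expr1n //.
  exact: dressing_bound nd n0 JA_bound dS x.
move=> l; have [_ /(_ x)[_ _ /(_ (1 - l%:Z))] H _ _ _] := dS.
have E : ((-1) ^ (1 - l%:Z) : R) = (-1) ^+ l.+1.
  rewrite expfzDr ?oppr_eq0 ?oner_eq0 // -exprnN exprS; congr (_ * _).
  by rewrite -exprVn invrN1.
move: H; rewrite E -/(cadj _) => /eqP; rewrite addr_eq0 => /eqP H.
have := congr1 (fun A => (-1) ^+ l.+1 *: A) H.
by rewrite scalerA -expr2 sqrr_sign scale1r scalerN.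
Qed.

End LoopPowers.

(** * From curve flows to KdV flows *)

Section Frames.
Variables (R : realType) (n : nat).
Local Notation mat := (Mat R n).
Local Notation vec := (Vec R n).
Local Notation Cn := (Cn R n).
Local Notation b_n := (b_n R n).
Local Notation E := (@stdcol R n).
Local Notation N := (2 * n).+1.

Lemma derive1_mul_cst p q r (A : R -> 'M[R]_(p, q)) (B : 'M[R]_(q, r)) x :
  smooth A -> derive1 (fun y => A y *m B) x = derive1 A x *m B.
Proof.
move=> sA; rewrite (derive1_mulmx x sA (smooth_cst B)).
by rewrite derive1_cst mulmx0 addr0.
Qed.

Lemma inO_mulI r (A : mat) (X Y : 'M[R]_(N, r)) :
  inO A -> A *m X = A *m Y -> X = Y.
Proof.
move=> /inO_invmx[_ VA _] /(congr1 (mulmx (invmx A))).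
by rewrite !mulmxA VA !mul1mx.
Qed.

Lemma VcoordE (A : mat) k : (k < 2 * n)%N ->
  Vcoord A (2 * n - 1 - k) = (A *m E k) (inord (2 * n - 1 - k)) 0.
Proof. by move=> kn; rewrite mulmx_stdcol /Vcoord; congr (A _ (inord _)); lia. Qed.

(** The uniqueness behind both definitions of the flows: an o(n+1,n)-valued [D]
    that kills [e1] and whose covariant derivative is V_n-valued vanishes. One
    column follows from the previous one. If the columns up to k vanish then the
    commutator sends E_k to - D E_(k+1), because b shifts E_k to E_(k+1) and u
    sends E_k to columns already known. So D E_(k+1) has the shape of a column of
    V_n; of its two possible entries, one repeats a coefficient that vanished at
    the previous step, and the other lies on the antidiagonal of [D], where
    elements of o(n+1,n) vanish. *)
Lemma rigidity (u D : R -> mat) : smooth D -> (forall x, inV (u x)) ->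
  (forall x, ino (D x)) -> (forall x, D x *m E 0 = 0) ->
  (forall x, inV (comm_dx (fun y => b_n + u y) D x)) -> forall x, D x = 0.
Proof.
move=> sD uV Do D0 EV; pose F := comm_dx (fun y => b_n + u y) D.
have FE k : (k < 2 * n)%N -> (forall l, (l <= k)%N -> forall x, D x *m E l = 0) ->
    forall x, F x *m E k = - (D x *m E k.+1).
  move=> kn Dk x; rewrite /F /comm_dx mulmxDl mulmxBl -derive1_mul_cst //.
  have -> : (fun y => D y *m E k) = (fun=> 0) by apply/funext => y; exact: Dk.
  rewrite derive1_cst add0r -mulmxA (Dk k (leqnn k)) mulmx0 sub0r.
  rewrite -mulmxA mulmxDl bn_stdcol //.
  rewrite (inV_stdcol (uV x) (ltnW kn)).
  rewrite mulmxDr mulmxDr -!scalemxAr.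
  case: (leqP n k) => nk /=; last by rewrite ifF ?scale0r ?addr0 //; lia.
  rewrite (Dk (2 * n - 1 - k)%N) ?scaler0 ?add0r; last by lia.
  case: ifP => nk'; last by rewrite scale0r addr0.
  by rewrite (Dk (2 * n + 1 - k)%N) ?scaler0 ?addr0 //; lia.
suff H k : (k <= 2 * n)%N -> forall l, (l <= k)%N -> forall x, D x *m E l = 0.
  by move=> x; apply: mx_stdcol_inj => k kn; rewrite mul0mx (H k).
elim: k => [_ l|k IH kn l lk x]; first by rewrite leqn0 => /eqP ->.
have {}IH := IH (ltnW kn).
case: (ltngtP l k.+1) lk => // [lk _|-> _]; first by exact: IH.
apply: oppr_inj; rewrite oppr0 -FE // (inV_stdcol (EV x) (ltnW kn)) -/(F x).
have -> : (if (n <= k < 2 * n)%N then Vcoord (F x) (2 * n - 1 - k) else 0) = 0.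
  case: ifP => // _; rewrite VcoordE // FE // mxE mulmx_stdcol ino_antidiag ?oppr0 //.
  by rewrite !inordK; lia.
have -> : (if (n < k)%N then Vcoord (F x) (2 * n - k) else 0) = 0.
  case: ifP => // nk; have k1 : (k.-1 < 2 * n)%N by lia.
  rewrite (_ : (2 * n - k)%N = (2 * n - 1 - k.-1)%N); last by lia.
  rewrite VcoordE // FE //; last by move=> m mk; apply: IH; lia.
  by rewrite prednK ?IH ?oppr0 ?mxE //; lia.
by rewrite !scale0r addr0.
Qed.

Lemma pairing_quad (X Y : vec) (c : R) :
  pairing (X + c *: Y) (X + c *: Y) =
  pairing X X + c * pairing X Y + c * pairing Y X + c * c * pairing Y Y.
Proof.
rewrite /pairing [(X + c *: Y)^T]linearD /= [(c *: Y)^T]linearZ /=.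
rewrite !(mulmxDl, mulmxDr) -!(scalemxAl, scalemxAr) !mxE.
by rewrite mulrA; ring.
Qed.

Lemma smooth_pairing (V : normedModType R) (X Y : V -> vec) :
  smooth X -> smooth Y -> smooth (fun z => pairing (X z) (Y z)).
Proof.
move=> sX sY; have := smooth_mulmx (smooth_mulmx (smooth_trmx sX) (smooth_cst Cn)) sY.
by move=> /smooth_mxP/(_ ord0 ord0).
Qed.

(** Each column of a moving frame after the middle one is determined by the
    previous columns through algebraic operations and one x-derivative, hence
    depends smoothly on both variables. In g_x = g (b + u), the derivative of
    column k gives, up to known terms, a vector
    h = g E_(k+1) + c g E_(2n-1-k) where c is the next coefficient of u. As g
    preserves the form, <h, h> = 2 (-1)^(n+k+1) c; this recovers first c, then
    the column k+1. *)
Lemma frame_smooth2 (g u : R -> R -> mat) :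
  (forall x t, inO (g x t)) -> (forall x t, inV (u x t)) ->
  (forall t, smooth (g^~ t)) ->
  (forall x t, derive1 (g^~ t) x = g x t *m (b_n + u x t)) ->
  (forall k, (k <= n)%N -> smooth2 (fun x t => g x t *m E k)) ->
  smooth2 g /\ smooth2 u.
Proof.
move=> gO uV sg gx gn.
have H m : (m <= n)%N ->
    (forall l, (l <= n + m)%N -> smooth2 (fun x t => g x t *m E l)) /\
    (forall l, (n <= l < n + m)%N ->
       smooth2 (fun x t => Vcoord (u x t) (2 * n - 1 - l))).
  elim: m => [_|m IH mn].
    by rewrite addn0; split => [|l]; [exact: gn|lia].
  have {IH}[IH1 IH2] := IH (ltnW mn); set k := (n + m)%N.
  have kn : (k < 2 * n)%N by rewrite /k; lia.
  pose c x t := Vcoord (u x t) (2 * n - 1 - k).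
  (* The coefficient already met in column k; at k = n there is none, and the
     column 2n+1-k that it would multiply is not yet known. *)
  pose d x t := if (n < k)%N then Vcoord (u x t) (2 * n - k) else 0.
  pose h x t :=
    derive1 (fun y => g y t *m E k) x - d x t *: (g x t *m E (2 * n + 1 - k)).
  have hE x t : h x t = g x t *m (E k.+1 + c x t *: E (2 * n - 1 - k)).
    rewrite /h derive1_mul_cst // gx -mulmxA mulmxDl bn_stdcol //.
    rewrite (inV_stdcol (uV x t) (ltnW kn)).
    rewrite ifT; last by rewrite kn /k leq_addr.
    by rewrite !mulmxDr -!scalemxAr addrA -/(c x t) -/(d x t) addrK.
  have sd : smooth2 (fun x t => d x t *: (g x t *m E (2 * n + 1 - k))).
    rewrite /d; case: (ltnP n k) => nk; last first.
      by refine (smooth_eq _ (smooth_cst 0)) => z; rewrite scale0r.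
    apply: smooth_scalemx; last by apply: IH1; rewrite /k; lia.
    rewrite (_ : (2 * n - k)%N = (2 * n - 1 - k.-1)%N); last by lia.
    by apply: IH2; lia.
  have sh : smooth2 h.
    apply: smooth_submx sd.
    exact: (smooth2_derivex (f := fun x t => g x t *m E k) (IH1 k (leqnn _))).
  have cE x t : c x t = 2^-1 * (-1) ^+ (n + k.+1) * pairing (h x t) (h x t).
    rewrite hE inO_form // pairing_quad !pairing_stdcol; try by rewrite /k; lia.
    rewrite (_ : (k.+1 + k.+1 == 2 * n)%N = false); last by rewrite /k; lia.
    rewrite (_ : (k.+1 + (2 * n - 1 - k) == 2 * n)%N); last by rewrite /k; lia.
    rewrite (_ : (2 * n - 1 - k + k.+1 == 2 * n)%N); last by rewrite /k; lia.
    rewrite (_ : (2 * n - 1 - k + (2 * n - 1 - k) == 2 * n)%N = false); last first.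
      by rewrite /k; lia.
    rewrite add0r mulr0 addr0.
    rewrite (_ : (-1) ^+ (n + (2 * n - 1 - k)) = (-1) ^+ (n + k.+1) :> R); last first.
      by rewrite -signr_odd -[RHS]signr_odd; congr (_ ^+ _); lia.
    have ss : (-1) ^+ (n + k.+1) * (-1) ^+ (n + k.+1) = 1 :> R.
      by rewrite -expr2 sqrr_sign.
    move: ((-1) ^+ (n + k.+1)) ss => s ss.
    by apply: etrans (_ : c x t = c x t * (s * s)) _; [rewrite ss mulr1|field].
  have sc : smooth2 c.
    refine (smooth_eq (fun z => cE z.1 z.2) _).
    by apply: smoothM; [exact: smooth_cst|exact: smooth_pairing].
  have s1 : smooth2 (fun x t => g x t *m E k.+1).
    refine (@smooth_eq _ _ _ _ (fun z =>
      h z.1 z.2 - c z.1 z.2 *: (g z.1 z.2 *m E (2 * n - 1 - k))) _ _).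
      by move=> z; rewrite hE mulmxDr -scalemxAr addrK.
    apply: smooth_submx; first exact: sh.
    by apply: smooth_scalemx; [exact: sc|apply: IH1; rewrite /k; lia].
  rewrite addnS -/k; split=> l lk.
    have [->|lk'] := eqVneq l k.+1; first exact: s1.
    by apply: IH1; lia.
  have [->|lk'] := eqVneq l k; first exact: sc.
  by apply: IH2; lia.
have [H1 _] := H n (leqnn n).
have s2g : smooth2 g.
  apply/smooth2_mxP => p q.
  have qn : (q <= n + n)%N by have := ltn_ord q; lia.
  have /smooth2_mxP/(_ p 0) := H1 q qn.
  apply: smooth_eq => z; by rewrite mulmx_stdcol inord_val.
split; first exact: s2g.
refine (@smooth_eq _ _ _ _ (fun z =>
  Cn *m (g z.1 z.2)^T *m Cn *m derive1 (g^~ z.2) z.1 - b_n) _ _).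
  move=> z; have [<- HV _] := inO_invmx (gO z.1 z.2).
  by rewrite gx mulmxA HV mul1mx addrC addKr.
apply: smooth_submx; last exact: smooth_cst.
apply: smooth_mulmx; last exact: (smooth2_derivex s2g).
apply: smooth_mulmx; last exact: smooth_cst.
by apply: smooth_mulmx; [exact: smooth_cst|exact: smooth_trmx s2g].
Qed.

Lemma inV_derive1 (u : R -> mat) t :
  smooth u -> (forall x, inV (u x)) -> inV (derive1 u t).
Proof.
move=> su uV; have uij := (smooth_mxP u).1 su.
exists (fun i => derive1 (fun x => Vcoord (u x) (n - i)) t).
apply/matrixP => p q; rewrite derive1_mxE; last exact: smooth_derivable.
rewrite summxE.
have -> : (fun y => u y p q) = (fun y => \sum_(1 <= i < n + 1)
    (Vcoord (u y) (n - i) * beta_ R n i p q)).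
  apply/funext => y; rewrite {1}(inV_decomp (uV y)) summxE.
  by apply: eq_bigr => i _; rewrite mxE.
have dV i : derivable (fun x => Vcoord (u x) (n - i)) t 1.
  exact/smooth_derivable/uij.
rewrite (derive1_sum _ _).2 => [|i]; last first.
  exact: derivableM (dV i) (derivable_cst _ _ _).
apply: eq_bigr => i _; rewrite [RHS]mxE.
rewrite !derive1E (deriveM (dV i) (derivable_cst _ _ _)) derive_cst scaler0 add0r.
exact: mulrC.
Qed.

Lemma curvature_frame (g : R -> mat) (u : mat) x : inO (g x) ->
  invmx (g x) *m derive1 g x = b_n + u -> derive1 g x = g x *m (b_n + u).
Proof. by move=> /inO_invmx[_ _ HV] <-; rewrite mulmxA HV mul1mx. Qed.

Lemma inNplus_e1 (A : mat) : inNplus A -> A *m e1 R n = 0.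
Proof.
move=> [_ A0]; rewrite e1_stdcol; apply/matrixP => p z.
rewrite ord1 mulmx_stdcol mxE A0 //.
by rewrite inordK.
Qed.

Lemma smooth2_derive1n (W : normedModType R) (f : R -> R -> W) k :
  smooth2 f -> smooth2 (fun x t => derive1n k (f^~ t) x).
Proof. by move=> sf; elim: k => [//|k IH]; exact: (smooth2_derivex IH). Qed.

(** Equality of the mixed derivatives of [g]. *)
Lemma zero_curvature (g u M : R -> R -> mat) x t :
  smooth2 g -> smooth2 u -> smooth2 M -> (forall x t, inO (g x t)) ->
  (forall x t, derive1 (g^~ t) x = g x t *m (b_n + u x t)) ->
  (forall x t, derive1 (g x) t = g x t *m M x t) ->
  derive1 (u x) t = comm_dx (fun y => b_n + u y t) (M^~ t) x.
Proof.
move=> sg su sM gO gx gt.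
have := derive1_comm x t sg.
have -> : (fun s => derive1 (g^~ s) x) = (fun s => g x s *m (b_n + u x s)).
  by apply/funext => s; exact: gx.
have -> : (fun y => derive1 (g y) t) = (fun y => g y t *m M y t).
  by apply/funext => y; exact: gt.
have sgt := smooth2_slicet x sg; have sut := smooth2_slicet x su.
have sbu : smooth (fun s => b_n + u x s) by apply: smooth_addmx (smooth_cst _) sut.
rewrite (derive1_mulmx t sgt sbu) (derive1_addmx t (smooth_cst _) sut).
rewrite derive1_cst add0r.
rewrite (derive1_mulmx x (smooth2_slicex t sg) (smooth2_slicex t sM)) gx gt.
rewrite -!mulmxA -!mulmxDr => /(inO_mulI (gO x t)) H.
by rewrite /comm_dx addrA [X in X - _]addrC -H addrC addKr.
Qed.

(** Differentiate g^T Cn g = Cn. *)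
Lemma inO_tangent (g M : R -> mat) t : smooth g -> (forall s, inO (g s)) ->
  derive1 g t = g t *m M t -> ino (M t).
Proof.
move=> sg gO gt.
have : derive1 (fun s => (g s)^T *m Cn *m g s) t = 0.
  rewrite (_ : (fun s => _) = (fun=> Cn)) ?derive1_cst //.
  by apply/funext => s; exact: gO.
have sgC := smooth_mulmx (smooth_trmx sg) (smooth_cst Cn).
rewrite (derive1_mulmx t sgC sg) (derive1_mul_cst Cn t (smooth_trmx sg)).
rewrite derive1_trmx // gt.
rewrite trmx_mul -!mulmxA (mulmxA Cn (g t)) (mulmxA (g t)^T (Cn *m g t)).
by rewrite (mulmxA (g t)^T Cn) gO.
Qed.

Definition smooth_ino_valued (Q0 : (R -> mat) -> R -> mat) :=
  forall u, CV u -> smooth (Q0 u) /\ (forall x, ino (Q0 u x)).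

(** With M = g^-1 g_t, zero curvature gives u_t = [d/dx + b + u, M]. Both M and
    the KdV operator N = Q0 - eta are o(n+1,n)-valued, have a covariant
    derivative in V_n, and agree on [e1]: the curve flow says M e1 = Q0 e1, and
    eta is strictly upper triangular. Rigidity gives M = N. *)
Lemma curve_to_KdV Q0 eta gamma g u : smooth_ino_valued Q0 -> is_eta Q0 eta ->
  curve_flow_solution Q0 gamma g u -> KdV_solution Q0 eta u.
Proof.
move=> rQ [_ He] [sgam gM mf uE gamt].
have uEt t : u^~ t = curvature (g^~ t) by apply/funext => x; exact: uE.
have uCV t : CV (u^~ t) by rewrite uEt; have [] := mf t.
have uV x t : inV (u x t) by have [_ /(_ x)] := uCV t.
have gO x t : inO (g x t) by have [_ /(_ x)] := mf t.
have sgx t : smooth (g^~ t) by have [] := mf t.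
have gx x t : derive1 (g^~ t) x = g x t *m (b_n + u x t).
  by apply: curvature_frame => //; rewrite uE /curvature addrC subrK.
have gE k x t : (k <= n)%N -> g x t *m E k = derive1n k (gamma^~ t) x.
  move=> kn; have [_ _ /(_ x k.+1) H _] := mf t.
  by rewrite -colE H //; lia.
have [sg su] : smooth2 g /\ smooth2 u.
  refine (frame_smooth2 gO uV sgx gx _) => k kn.
  by refine (smooth_eq _ (smooth2_derive1n k sgam)) => z; exact: gE.
split; [exact: su|exact: uV|move=> x t].
pose M x t := Cn *m (g x t)^T *m Cn *m derive1 (g x) t.
have sM : smooth2 M.
  apply: smooth_mulmx; last exact: (smooth2_derivet sg).
  apply: smooth_mulmx; last exact: smooth_cst.
  by apply: smooth_mulmx; [exact: smooth_cst|exact: smooth_trmx sg].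
have gt y s : derive1 (g y) s = g y s *m M y s.
  by have [iE _ HV] := inO_invmx (gO y s); rewrite /M -iE mulmxA HV mul1mx.
have ut y s := zero_curvature y s sg su sM gO gx gt.
have [sQ oQ] := rQ _ (uCV t); have [seta Neta CVe] := He _ (uCV t).
pose Nn y := Q0 (u^~ t) y - eta (u^~ t) y.
have sN : smooth Nn := smooth_submx sQ seta.
have sMt := smooth2_slicex t sM.
have commB y : comm_dx (fun y => b_n + u y t) (fun y => M y t - Nn y) y =
    derive1 (u y) t - comm_dx (fun y => b_n + u y t) Nn y.
  rewrite ut /comm_dx (derive1_submx y sMt sN) mulmxBr mulmxBl.
  rewrite [in RHS]opprD [RHS]addrACA; congr (_ + _).
  by rewrite !opprB addrACA [RHS]addrACA; congr (_ + _); exact: addrC.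
have D0 : forall y, M y t - Nn y = 0.
  refine (@rigidity (u^~ t) _ (smooth_submx sMt sN) (fun y => uV y t) _ _ _) => y.
  - apply: ino_sub; first exact: (@inO_tangent (g y) (M y) t (smooth2_slicet y sg)).
    by apply: ino_sub => //; have [] := Neta y.
  - rewrite mulmxBl /Nn mulmxBl -e1_stdcol (inNplus_e1 (Neta y)) subr0.
    have : g y t *m (M y t *m e1 R n) = g y t *m (Q0 (u^~ t) y *m e1 R n).
      rewrite [LHS]mulmxA [RHS]mulmxA -gamt -gt.
      rewrite -(derive1_mul_cst _ _ (smooth2_slicet y sg)).
      congr (derive1 _ t); apply/funext => s.
      by rewrite e1_stdcol gE.
    by move=> /(inO_mulI (gO y t)) ->; rewrite subrr.
  - rewrite commB; apply: inV_sub; last by have [_] := CVe.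
    exact: inV_derive1 (smooth2_slicet y su) _.
have := commB x; rewrite (_ : (fun y => M y t - Nn y) = (fun=> 0)); last first.
  by apply/funext => y; exact: D0.
rewrite /comm_dx derive1_cst mulmx0 mul0mx subrr addr0 => /esym/eqP.
by rewrite subr_eq0 => /eqP.
Qed.

End Frames.

(** * From KdV flows to curve flows *)

Section Curves.
Variables (R : realType) (n : nat).
Local Notation mat := (Mat R n).
Local Notation vec := (Vec R n).
Local Notation Cn := (Cn R n).
Local Notation b_n := (b_n R n).
Local Notation E := (@stdcol R n).
Local Notation N := (2 * n).+1.

Lemma inV_upper (A : mat) (p q : 'I_N) : inV A -> (q <= p)%N -> A p q = 0.
Proof. by move=> AV qp; rewrite inV_entry // !ifF ?addr0 //; lia. Qed.

Section Curve.
Variables (g u : R -> mat).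
Hypotheses (sg : smooth g) (su : smooth u) (uV : forall x, inV (u x)).
Hypothesis gO : forall x, inO (g x).
Hypothesis gx : forall x, derive1 g x = g x *m (b_n + u x).
Let gamma x := g x *m e1 R n.

Lemma derive_frame_vec (w : R -> vec) x : smooth w ->
  derive1 (fun y => g y *m w y) x =
  g x *m (derive1 w x + (b_n + u x) *m w x).
Proof.
by move=> sw; rewrite (derive1_mulmx x sg sw) gx [RHS]mulmxDr mulmxA addrC.
Qed.

Lemma frame_column k x : (k <= n)%N -> derive1n k gamma x = g x *m E k.
Proof.
elim: k x => [x _|k IH x kn]; first by rewrite derive1n0 /gamma e1_stdcol.
rewrite derive1nS.
have -> : derive1n k gamma = (fun y => g y *m E k).
  by apply/funext => y; exact: IH (ltnW kn).
rewrite (derive1_mul_cst _ _ sg) gx -mulmxA mulmxDl bn_stdcol; last by lia.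
have k2 : (k <= 2 * n)%N by lia.
by rewrite (inV_stdcol (uV x) k2) !ifF ?scale0r ?addr0 //; lia.
Qed.

(** The k-th derivative of the curve is [g] times a vector with leading entry 1
    in position k: differentiation acts on coefficient vectors as
    w' + (b + u) w, where b shifts the leading entry and u is strictly upper
    triangular. *)
Lemma unitriangular_jet k : (k <= 2 * n)%N -> exists w : R -> vec,
  [/\ smooth w, forall x, derive1n k gamma x = g x *m w x,
    forall x, w x (inord k) 0 = 1 &
    forall x (p : 'I_N), (k < p)%N -> w x p 0 = 0].
Proof.
elim: k => [_|k IH kn].
  exists (fun=> E 0); split => [|x|x|x p p0].
  - exact: smooth_cst.
  - by rewrite derive1n0 /gamma e1_stdcol.
  - by rewrite mxE !eqxx.
  - by rewrite mxE -val_eqE /= inordK // eqn0Ngt p0.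
have [w [sw gw w1 w0]] := IH (ltnW kn).
have sw' := smooth_derive1 sw.
pose w' x := derive1 w x + (b_n + u x) *m w x.
have w'E x (p : 'I_N) : (k < p)%N -> w' x p 0 = w x (inord p.-1) 0.
  move=> kp; rewrite mxE derive1_mxE; last exact: smooth_derivable.
  rewrite (_ : (fun y => w y p 0) = (fun=> 0)); last first.
    by apply/funext => y; exact: w0.
  rewrite derive1_cst add0r mxE (bigD1 (inord p.-1)) //= big1 => [|q qp].
    rewrite mxE b_nE inV_upper ?inordK ?prednK ?eqxx ?addr0 ?mul1r //;
      have := ltn_ord p; lia.
  case: (ltnP k q) => kq; first by rewrite w0 ?mulr0.
  rewrite mxE b_nE inV_upper //; last by lia.
  rewrite (_ : (p == q.+1 :> nat) = false) ?addr0 ?mul0r //.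
  apply: contraNF qp => /eqP pq; apply/eqP/val_inj; rewrite /= inordK pq //.
  exact: ltn_ord q.
exists w'; split => [|x|x|x p kp].
- exact: smooth_addmx sw' (smooth_mulmx (smooth_addmx (smooth_cst _) su) sw).
- rewrite derive1nS (_ : derive1n k gamma = (fun y => g y *m w y)).
    exact: derive_frame_vec.
  by apply/funext.
- rewrite w'E inordK //.
- by rewrite (w'E _ _ (ltnW kp)) w0 // inordK; have := ltn_ord p; lia.
Qed.

Lemma free_jet x : free [seq derive1n k gamma x | k <- iota 0 N].
Proof.
set X := map _ _; have sX : size X = N by rewrite size_map size_iota.
rewrite -[X]/(tval (in_tuple X)); apply/freeP => c c0.
have XE (i : 'I_(size X)) : (in_tuple X)`_i = derive1n i gamma x.
  have iN : (i < N)%N := leq_trans (ltn_ord i) (eq_leq sX).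
  by rewrite /= (nth_map 0%N) ?size_iota // nth_iota.
(* Read the relation in the frame and take entries from the last one down: the
   entry i only involves the coefficients c j with j >= i. *)
suff H d (i : 'I_(size X)) : (N - i <= d)%N -> c i = 0 by move=> i; apply: H (leqnn _).
elim: d i => [|d IH] i id.
  by have := leq_trans (ltn_ord i) (eq_leq sX); lia.
have iN : (i < N)%N := leq_trans (ltn_ord i) (eq_leq sX).
have [_ VA _] := inO_invmx (gO x).
have cE (l : 'I_(size X)) (w : R -> vec) : derive1n l gamma x = g x *m w x ->
    (invmx (g x) *m (c l *: (in_tuple X)`_l)) (inord i) 0 = c l * w x (inord i) 0.
  by move=> gw; rewrite -scalemxAr mxE XE gw mulmxA VA mul1mx.
have /matrixP/(_ (inord i) 0) :
    invmx (g x) *m (\sum_(l < size X) c l *: (in_tuple X)`_l) = 0.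
  by rewrite c0 mulmx0.
rewrite mulmx_sumr summxE [RHS]mxE (bigD1 i) //= big1 => [|l li].
  have [w [_ gw w1 _]] := unitriangular_jet (iN : (i <= 2 * n)%N).
  by rewrite (cE _ _ (gw x)) w1 mulr1 addr0.
have lN : (l < N)%N := leq_trans (ltn_ord l) (eq_leq sX).
have [w [_ gw _ w0]] := unitriangular_jet (lN : (l <= 2 * n)%N).
rewrite (cE _ _ (gw x)); case: (ssrnat.ltngtP i l) => il.
- have ld : (N - l <= d)%N by lia.
  by rewrite (IH l ld) mul0r.
- by rewrite w0 ?mulr0 // inordK.
- by move: li; rewrite (ord_inj il) eqxx.
Qed.

Lemma stdcolE k (p : 'I_N) : E k p 0 = (p == inord k)%:R.
Proof. by rewrite mxE eqxx andbT. Qed.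

Lemma pairing_sum (X Y : vec) :
  pairing X Y = \sum_p X p 0 * ((-1) ^+ (n + p) * Y (rev_ord p) 0).
Proof.
rewrite /pairing -mulmxA mxE; apply: eq_bigr => p _.
by rewrite mxE Cn_mulE.
Qed.

Let U x := <<[seq derive1n k gamma x | k <- iota 0 n]>>%VS.

Lemma mem_U x (X : vec) :
  reflect (forall p : 'I_N, (n <= p)%N -> (invmx (g x) *m X) p 0 = 0) (X \in U x).
Proof.
have [_ VA AV] := inO_invmx (gO x); apply: (iffP idP) => [XU p np|X0].
  pose s := in_tuple [seq derive1n k gamma x | k <- iota 0 n].
  have -> : X = \sum_i coord s i X *: s`_i by exact: coord_span.
  rewrite mulmx_sumr summxE big1 // => i _.
  have ss : size [seq derive1n k gamma x | k <- iota 0 n] = n.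
    by rewrite size_map size_iota.
  have iN : (i < n)%N := leq_trans (ltn_ord i) (eq_leq ss).
  have iN2 : (i < N)%N by lia.
  have pi : (p == i :> nat) = false by lia.
  rewrite -scalemxAr mxE /= (nth_map 0%N) ?size_iota // nth_iota // add0n.
  rewrite frame_column ?(ltnW iN) // mulmxA VA mul1mx mxE.
  rewrite -val_eqE /= inordK; last exact: iN2.
  by rewrite pi mulr0.
have -> : X = \sum_(p : 'I_N) (invmx (g x) *m X) p 0 *: (g x *m E p).
  rewrite -{1}[X]mul1mx -AV -mulmxA {1}[invmx (g x) *m X]matrix_sum_delta.
  rewrite mulmx_sumr; apply: eq_bigr => p _; rewrite big_ord1 -scalemxAr.
  by rewrite /E inord_val.
apply: memv_suml => p _; case: (leqP n p) => np; first by rewrite X0 // scale0r mem0v.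
apply: memvZ; apply: memv_span; apply/mapP; exists (p : nat).
  by rewrite mem_iota.
by rewrite frame_column // ltnW.
Qed.

(** In the frame the first n derivatives are E_0, ..., E_(n-1), which are
    mutually orthogonal. A vector z orthogonal to all of them has no entry after
    the middle one, and then <z, z> is the square of its middle entry up to sign;
    so an isotropic z lies in their span. *)
Lemma jet_maximal_isotropic x : maximal_isotropic (U x).
Proof.
have [_ VA AV] := inO_invmx (gO x).
have pg (X Y : vec) : pairing X Y = pairing (invmx (g x) *m X) (invmx (g x) *m Y).
  by rewrite -[RHS](inO_form _ _ (gO x)) !mulmxA AV !mul1mx.
split=> [X Y /mem_U X0 /mem_U Y0|W Wiso UW].
  rewrite pg pairing_sum big1 // => p _.
  case: (leqP n p) => np; first by rewrite X0 ?mul0r.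
  by rewrite Y0 ?mulr0 //=; lia.
apply/esym/eqP; rewrite eqEsubv UW /=; apply/subvP => Y YW; apply/mem_U => p np.
have H (q : 'I_N) : (n < q)%N -> (invmx (g x) *m Y) q 0 = 0.
  move=> nq; have rU : g x *m E (rev_ord q) \in U x.
    apply/mem_U => k nk; rewrite mulmxA VA mul1mx mxE -val_eqE /= inordK; last by lia.
    by rewrite (_ : (k == (N - q.+1)%N :> nat) = false) //; have := ltn_ord q; lia.
  have := Wiso _ _ (subvP UW _ rU) YW.
  rewrite pg mulmxA VA mul1mx pairing_sum (bigD1 (rev_ord q)) // big1 => [|k kq].
    rewrite stdcolE inord_val eqxx mul1r /= addr0 rev_ordK => /eqP.
    by rewrite mulf_eq0 signr_eq0 => /eqP.
  by rewrite stdcolE inord_val (negbTE kq) mul0r.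
case: (ssrnat.ltngtP n p) np => // [np _|np _]; first exact: H.
have := Wiso _ _ YW YW; rewrite pg pairing_sum (bigD1 p) //= big1 => [|k kp].
  rewrite addr0 (_ : rev_ord p = p); last by apply: val_inj => /=; lia.
  move=> /eqP; rewrite !mulf_eq0 signr_eq0 /= orbb => /eqP //.
case: (ltnP n k) => nk; first by rewrite H ?mul0r.
have kn : (k < n)%N.
  rewrite ltn_neqAle nk andbT; apply: contraNneq kp => kn.
  by apply/eqP/val_inj; rewrite /= kn.
by rewrite (H (rev_ord k)) ?mulr0 //=; lia.
Qed.

Lemma smooth_frame_curve : smooth gamma.
Proof. exact: smooth_mulmx sg (smooth_cst _). Qed.

Lemma frame_curve_inM : inM gamma.
Proof.
split; last first.
  move=> x; rewrite frame_column // inO_form // pairing_stdcol ?leq_pmull //.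
  by rewrite mul2n addnn eqxx -signr_odd odd_double.
split; [exact: smooth_frame_curve|exact: free_jet|exact: jet_maximal_isotropic].
Qed.

End Curve.

(** Since eta kills [e1], the curve g e1 moves by g_t e1 = g Q0 e1. *)
Lemma KdV_to_curve Q0 eta u c0 g : is_eta Q0 eta ->
  KdV_solution Q0 eta u -> frame_solution Q0 eta u c0 g ->
  curve_flow_solution Q0 (fun x t => g x t *m e1 R n) g u.
Proof.
move=> [_ He] [su uV _] [sg gO gxE gtE _].
have sut t := smooth2_slicex t su; have sgt t := smooth2_slicex t sg.
have uVt t x : inV (u^~ t x) by exact: uV.
have gOt t x : inO (g^~ t x) by exact: gO.
have gx t x : derive1 (g^~ t) x = g x t *m (b_n + u x t).
  exact: curvature_frame (gOt t x) (gxE x t).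
have uE x t : u x t = curvature (g^~ t) x.
  by rewrite /curvature gxE addrC addKr.
have uEt t : curvature (g^~ t) = u^~ t by apply/funext => x; rewrite uE.
have uCV t : CV (u^~ t) by split.
split.
- exact: smooth_mulmx sg (smooth_cst _).
- by move=> t; exact: (frame_curve_inM (sgt t) (sut t) (uVt t) (gOt t) (gx t)).
- move=> t; split; [exact: sgt|exact: gOt| |by rewrite uEt].
  move=> x i /andP[i0 iN]; rewrite colE; apply/esym.
  by apply: (frame_column (sgt t) (uVt t) (gx t)); lia.
- exact: uE.
- move=> x t; rewrite (derive1_mul_cst _ _ (smooth2_slicet x sg)).
  have [_ _ HV] := inO_invmx (gO x t).
  have -> : derive1 (g x) t = g x t *m (Q0 (u^~ t) x - eta (u^~ t) x).
    by rewrite -gtE mulmxA HV mul1mx.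
  rewrite mulmxBr mulmxBl.
  have [_ Ne _] := He _ (uCV t).
  by rewrite -(mulmxA _ (eta _ _)) (inNplus_e1 (Ne x)) mulmx0 subr0.
Qed.

End Curves.

Theorem theorem5p4 (R : realType) (n j : nat) (hn : (1 <= n)%N) (hj : (1 <= j)%N) :
  (* B-type *)
  (forall (P : (R -> Mat R n) -> R -> loop_series R n)
          (eta : (R -> Mat R n) -> R -> Mat R n),
     is_P P -> is_eta (lambda0_coef P j) eta ->
     (forall (gamma : R -> R -> Vec R n)
             (g u : R -> R -> Mat R n),
        curve_flow_solution (lambda0_coef P j) gamma g u ->
        KdV_solution (lambda0_coef P j) eta u) /\
     (forall (u : R -> R -> Mat R n) (c0 : Mat R n)
             (g : R -> R -> Mat R n),
        KdV_solution (lambda0_coef P j) eta u -> inO c0 ->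
        frame_solution (lambda0_coef P j) eta u c0 g ->
        curve_flow_solution (lambda0_coef P j) (fun x t => g x t *m e1 R n) g u))
  /\
  (* A-type *)
  (~~ (2 * n + 1 %| 2 * j - 1)%N ->
   forall (S : (R -> Mat R n) -> R -> loop_series R n)
          (eta : (R -> Mat R n) -> R -> Mat R n),
     is_S S -> is_eta (lambda0_coef S j) eta ->
     (forall (gamma : R -> R -> Vec R n)
             (g u : R -> R -> Mat R n),
        curve_flow_solution (lambda0_coef S j) gamma g u ->
        KdV_solution (lambda0_coef S j) eta u) /\
     (forall (u : R -> R -> Mat R n) (c0 : Mat R n)
             (g : R -> R -> Mat R n),
        KdV_solution (lambda0_coef S j) eta u -> inO c0 ->
        frame_solution (lambda0_coef S j) eta u c0 g ->
        curve_flow_solution (lambda0_coef S j) (fun x t => g x t *m e1 R n) g u)).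
Proof.
split=> [P eta PP He|_ S eta SS He]; split=> [gamma g u|u c0 g Hu _].
- by apply: curve_to_KdV He => v; exact: P_regular.
- exact: KdV_to_curve He Hu.
- by apply: curve_to_KdV He => v; exact: S_regular.
- exact: KdV_to_curve He Hu.
Qed.
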